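(* For each integer $n\ge 1$ let $\xi_n$ be the random variable with probability generating function $C_n(q)/C_n$, where $C_n(q)$ is the $q$-Catalan number and $C_n=C_n(1)$ is the Catalan number. Then, as $n\to\infty$, the standardized random variable $$\eta_n=\frac{\xi_n-E(\xi_n)}{\operatorname{Var}(\xi_n)^{1/2}}$$ has the standard normal distribution in the limit, i.e. $\eta_n$ converges in distribution to $N(0,1)$.
   Context: Notation: $[n]=1+q+\cdots+q^{n-1}$, $[n]!=[1][2]\cdots[n]$, and ${n\brack k}=\frac{[n]!}{[k]!\,[n-k]!}$. The $q$-Catalan number is $C_n(q)=\frac{1}{[n+1]}{2n\brack n}$, a polynomial in $q$ with nonnegative integer coefficients, and $C_n=\frac{1}{n+1}\binom{2n}{n}=C_n(1)$. Writing $C_n(q)=\sum_k m_n(k)q^k$, the random variable $\xi_n$ satisfies $P(\xi_n=k)=m_n(k)/C_n$. (The variance is positive for $n\ge 2$, so $\eta_n$ is defined for $n\geq 2$.) *)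

(* Defs.v *)
From HB Require Import structures.
From mathcomp Require Import all_boot all_order all_algebra.
From mathcomp Require Import all_classical all_reals all_analysis.
From mathcomp Require Import measurable_realfun.
From mathcomp Require Import ring.

Set Implicit Arguments.
Unset Strict Implicit.
Unset Printing Implicit Defensive.
Import Order.TTheory GRing.Theory Num.Theory.
Import numFieldNormedType.Exports.

Local Open Scope classical_set_scope.
Local Open Scope ring_scope.

Definition qnum (n : nat) : {poly int} := \sum_(i < n) 'X^i.

Definition qfact (n : nat) : {poly int} := \prod_(1 <= i < n.+1) qnum i.

(* The divisors below are monic, so %/ is Euclidean division in {poly int};
   both divisions are exact: see qbinomM (for k <= n) and qcatalanM. *)
Definition qbinom (n k : nat) : {poly int} :=
  qfact n %/ (qfact k * qfact (n - k)).

Definition qcatalan (n : nat) : {poly int} := qbinom (2 * n) n %/ qnum n.+1.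

Definition catalan (n : nat) : nat := ('C(2 * n, n) %/ n.+1)%N.

Lemma qnumE n : qnum n = \poly_(i < n) 1.
Proof. by rewrite poly_def; apply: eq_bigr => i _; rewrite scale1r. Qed.

Lemma qnum_monic n : qnum n.+1 \is monic.
Proof. by rewrite qnumE monicE lead_coef_poly ?oner_eq0. Qed.

Lemma qnumD m n : qnum (m + n) = qnum m + 'X^m * qnum n.
Proof.
rewrite /qnum big_split_ord /= mulr_sumr; congr (_ + _).
by apply: eq_bigr => i _; rewrite exprD.
Qed.

Lemma qfact0 : qfact 0 = 1.
Proof. by rewrite /qfact big_nil. Qed.

Lemma qfactS n : qfact n.+1 = qfact n * qnum n.+1.
Proof. by rewrite /qfact big_nat_recr. Qed.

Lemma qfact_monic n : qfact n \is monic.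
Proof.
elim: n => [|n IH]; first by rewrite qfact0 monic1.
by rewrite qfactS monicMl // qnum_monic.
Qed.

Lemma qfact_dvd m n : exists c, qfact (m + n) = c * (qfact m * qfact n).
Proof.
elim: m n => [|m IHm] n; first by exists 1; rewrite add0n qfact0 !mul1r.
elim: n => [|n [b Eb]]; first by exists 1; rewrite addn0 qfact0 mulr1 mul1r.
have [a Ea] := IHm n.+1.
exists (b + 'X^(n.+1) * a).
have -> : qfact (m.+1 + n.+1) = qfact (m.+1 + n) * qnum (n.+1 + m.+1).
  by rewrite addnS qfactS addSn addnC -addnS.
rewrite qnumD mulrDr {1}Eb addSnnS Ea (qfactS m) (qfactS n); ring.
Qed.

Lemma qbinomM n k : (k <= n)%N ->
  qbinom n k * (qfact k * qfact (n - k)) = qfact n.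
Proof.
move=> le_kn; have [c Ec] := qfact_dvd k (n - k).
rewrite subnKC // in Ec.
by rewrite /qbinom Ec Pdiv.IdomainMonic.mulpK // monicMl qfact_monic.
Qed.

Lemma qcatalanM n : qcatalan n * qnum n.+1 = qbinom (2 * n) n.
Proof.
have [c Ec] := qfact_dvd n.+1 n.-1.
have Qreg k : qfact k != 0 by rewrite monic_neq0 ?qfact_monic.
suff [r Er] : exists r, qbinom (2 * n) n = r * qnum n.+1.
  by rewrite /qcatalan Er Pdiv.IdomainMonic.mulpK // qnum_monic.
case: n c Ec => [|n] c Ec.
  by exists (qbinom 0 0); rewrite muln0 /qnum big_ord1 expr0 mulr1.
exists (qbinom (2 * n.+1) n.+1 - 'X * c).
have nn : (2 * n.+1 - n.+1 = n.+1)%N by rewrite mul2n -addnn addnK.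
have nn2 : (2 * n.+1 = n.+2 + n)%N by rewrite mul2n -addnn addSnnS addnC.
have Eb : qbinom (2 * n.+1) n.+1 * (qfact n.+1 * qfact n.+1) =
    c * (qfact n.+2 * qfact n).
  by rewrite -Ec -nn2 -[in X in _ * (_ * X)]nn qbinomM // mul2n -addnn leq_addr.
have E1 : qbinom (2 * n.+1) n.+1 * qnum n.+1 = c * qnum n.+2.
  apply: (mulIf (mulf_neq0 (Qreg n.+1) (Qreg n))).
  by move: Eb; rewrite (qfactS n.+1) {2}(qfactS n) => Eb; ring: Eb.
have E2 : qnum n.+2 = 1 + 'X * qnum n.+1.
  by rewrite -[n.+2]add1n qnumD expr1 /qnum big_ord1 expr0.
rewrite mulrBl -['X * c * _]mulrA -E1 E2; ring.
Qed.

Lemma qnum1 n : (qnum n).[1] = n%:R.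
Proof.
rewrite /qnum horner_sum (eq_bigr (fun=> 1)) => [|i _].
  by rewrite sumr_const card_ord.
by rewrite hornerXn expr1n.
Qed.

Lemma qfact1 n : (qfact n).[1] = n`!%:R.
Proof.
elim: n => [|n IH]; first by rewrite qfact0 hornerC.
by rewrite qfactS hornerM IH qnum1 -natrM factS mulnC.
Qed.

Lemma qcatalan1 n : (qcatalan n).[1] = (catalan n)%:R.
Proof.
have le_n2n : (n <= 2 * n)%N by rewrite mul2n -addnn leq_addr.
have fact0 k : (k`!%:R : int) != 0 by rewrite pnatr_eq0 -lt0n fact_gt0.
have B : (qbinom (2 * n) n).[1] = 'C(2 * n, n)%:R.
  have /(congr1 (horner^~ 1)) := qbinomM le_n2n.
  rewrite !hornerM !qfact1 -(bin_fact le_n2n) !natrM.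
  by move/(mulIf (mulf_neq0 (fact0 _) (fact0 _))).
have /(congr1 (horner^~ 1)) := qcatalanM n.
rewrite hornerM qnum1 B /catalan => E.
have [m Em] : exists m : nat, (qcatalan n).[1] = m%:R.
  exists `|(qcatalan n).[1]|%N; rewrite natz gez0_abs //.
  by rewrite -(@pmulr_lge0 _ n.+1%:R) ?ltr0n // E ler0n.
move/eqP: E; rewrite Em -natrM eqr_nat => /eqP <-.
by rewrite mulnK.
Qed.

Section standardize.
Context d (T : measurableType d) (R : realType) (P : probability T R).

Definition standardize (X : {RV P >-> R}) (w : T) : R :=
  (X w - fine 'E_P[X]) / Num.sqrt (fine 'V_P[X]).

Lemma measurable_standardize (X : {RV P >-> R}) :
  measurable_fun [set: T] (standardize X).
Proof. by apply: measurable_funM => //; exact: measurable_funB. Qed.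

HB.instance Definition _ (X : {RV P >-> R}) :=
  isMeasurableFun.Build _ _ T R (standardize X) (measurable_standardize X).

End standardize.

Arguments standardize {d T R} P X.

(* Convergence of the distribution functions at every continuity point of the
   limit; the X n may live on different probability spaces. *)
Definition cvg_in_distribution (R : realType) (d : nat -> measure_display)
    (T : forall n, measurableType (d n)) (P : forall n, probability (T n) R)
    (X : forall n, {RV (P n) >-> R})
    (Q : probability (measurableTypeR R) R) : Prop :=
  forall x : R, {for x, continuous (fun y : R => Q `]-oo, y]%classic)} ->
    cdf (X n) x @[n --> \oo] --> Q `]-oo, x]%classic.

Arguments cvg_in_distribution {R d T} P X Q.

(* Main.v *)
Require Import Defs.
From HB Require Import structures.
From mathcomp Require Import all_boot all_order all_algebra.
From mathcomp Require Import all_classical all_reals all_analysis.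
From mathcomp Require Import measurable_realfun complex.
From mathcomp Require Import ring lra zify.

(* The product formula C_n(q) = prod_(2 <= j <= n) [n+j]/[j] gives everything.
   Mean and variance are additive over products of polynomials, so they equal
   n(n-1)/2 and n(n^2-1)/6.  Evaluating the product at q = e^(2it) shows that
   the centered law has the real characteristic function
   prod_j (j sin((n+j)t)) / ((n+j) sin(jt)); since
   sin x = x exp(-x^2/6 + O(x^4)), taking 2t = s/sigma_n the quadratic terms
   add up to -s^2/2 exactly, while the error is n O(1/n^2).
   For the continuity theorem, tightness is Chebyshev's inequality, and an
   indicator 1_(y <= a) is approximated on a large interval by a trigonometric
   polynomial: an iterate of the cubic v |-> (3v - v^3)/2, which pushes
   [-1, 1] \ {0} to the signs, evaluated at sin((y - a)/M). *)

Set Implicit Arguments.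
Unset Strict Implicit.
Unset Printing Implicit Defensive.
Import Order.TTheory GRing.Theory Num.Theory.
Import numFieldNormedType.Exports.

Local Open Scope classical_set_scope.
Local Open Scope ring_scope.

(** * The product formula and its moments *)

(** The ratios [n+j]/[j] are in general not polynomials, so the product formula does not present the
    law as that of a sum of independent variables, and a central limit theorem for such sums does
    not apply. What survives the division is whatever is multiplicative or additive over products:
    values on the unit circle, and the first two cumulants. On the circle each ratio carries the
    phase e^(int); the n-1 phases together are exactly the shift by the mean, which is why the
    centered characteristic function is real. The quadratic terms match exactly because the sum over
    2 <= j <= n of ((n+j)^2 - j^2)/6 is n(n^2-1)/3, twice the variance. The error has its order
    because sigma_n^2 grows like n^3: all angles are O(n^(-1/2)), and each factor is wrong by a
    fourth power of an angle. The normal transform comes from the differential equation F' = -tF.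
    Limits are taken with real integrals only: the phase b in cos(ax + b) covers cosines and sines
    at once. *)

Lemma qcatalan_prod n : (0 < n)%N ->
  qcatalan n * \prod_(2 <= j < n.+1) qnum j = \prod_(2 <= j < n.+1) qnum (n + j).
Proof.
move=> n0; have le_n2n : (n <= 2 * n)%N by lia.
have F1 : qfact n = \prod_(2 <= j < n.+1) qnum j.
  rewrite /qfact big_ltn //; suff -> : qnum 1 = 1 by rewrite mul1r.
  by rewrite /qnum big_ord1 expr0.
have F2 m k : qfact (m + k) = qfact m * \prod_(1 <= j < k.+1) qnum (m + j).
  elim: k => [|k IH]; first by rewrite addn0 big_geq ?mulr1.
  by rewrite addnS qfactS IH [in RHS]big_nat_recr //= addnS mulrA.
have B := qbinomM le_n2n; move: B; rewrite -qcatalanM.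
rewrite (_ : (2 * n - n = n)%N); last lia.
(* Peeling off [j = 1] isolates [qnum n.+1], which cancels the divisor in [qcatalan]; this is why
   both products start at 2. *)
rewrite mul2n -addnn F2 big_ltn // addn1 => E.
apply: (mulIf (mulf_neq0 (monic_neq0 (qfact_monic n)) (monic_neq0 (qnum_monic n)))).
by rewrite -{1}F1; ring: E.
Qed.

Section logarithmic_moments.
Variable F : fieldType.
Implicit Types p q : {poly F}.

(* If p/p(1) is the probability generating function of X, then E X = pmean p
   and Var X = pvar p. *)
Definition pmean p : F := p^`().[1] / p.[1].
Definition pvar p : F := p^`()^`().[1] / p.[1] + pmean p - pmean p ^+ 2.

(** [pmean] is the logarithmic derivative at 1, and [pvar] is the value at 1 of (x d/dx)^2 log p.
    Both are additive for any polynomials that do not vanish at 1, whether or not they are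
    generating functions. *)
Lemma pmeanM p q : p.[1] != 0 -> q.[1] != 0 ->
  pmean (p * q) = pmean p + pmean q.
Proof.
move=> p0 q0; rewrite /pmean derivM !(hornerM, hornerD); field.
by rewrite p0 q0.
Qed.

Lemma pvarM p q : p.[1] != 0 -> q.[1] != 0 -> pvar (p * q) = pvar p + pvar q.
Proof.
move=> p0 q0; rewrite /pvar /pmean !(derivM, derivD) !(hornerM, hornerD); field.
by rewrite p0 q0.
Qed.

Lemma pmean_prod (I : eqType) (r : seq I) (f : I -> {poly F}) :
  (forall i, (f i).[1] != 0) ->
  pmean (\prod_(i <- r) f i) = \sum_(i <- r) pmean (f i) /\
  pvar (\prod_(i <- r) f i) = \sum_(i <- r) pvar (f i).
Proof.
move=> f0; elim: r => [|i r [IHm IHv]].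
  rewrite !big_nil /pvar /pmean -[1]/(1%:P) !derivC !hornerC.
  by rewrite !mul0r expr0n subr0 addr0.
have r0 : (\prod_(i <- r) f i).[1] != 0.
  by rewrite horner_prod prodf_seq_neq0; apply/allP => j _; rewrite f0.
by rewrite !big_cons pmeanM // pvarM // IHm IHv.
Qed.

End logarithmic_moments.

Section qnum_moments.
Variable F : numFieldType.
Local Notation toF := (map_poly (intr : int -> F)).

Lemma qnum_moments n : [/\ (toF (qnum n)).[1] = n%:R,
  (toF (qnum n))^`().[1] = n%:R * (n%:R - 1) / 2 &
  (toF (qnum n))^`()^`().[1] = n%:R * (n%:R - 1) * (n%:R - 2) / 3].
Proof.
elim: n => [|n [IH0 IH1 IH2]].
  by rewrite /qnum big_ord0 rmorph0 !deriv0 horner0 !mul0r.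
have -> : toF (qnum n.+1) = toF (qnum n) + 'X^n.
  by rewrite /qnum big_ord_recr /= rmorphD /= map_polyXn.
rewrite !(derivD, derivXn, derivMn) !(hornerD, hornerMn, hornerXn) IH0 IH1 IH2.
rewrite !expr1n -natr1; split; [by [] | by field |].
(* The second derivative of ['X^n] brings in [n.-1], whose truncation at 0 is treated apart. *)
by case: n {IH0 IH1 IH2} => [|n] /=; rewrite -?natr1; field.
Qed.

Lemma pmean_qnum n : pmean (toF (qnum n.+1)) = n%:R / 2.
Proof.
have [E0 E1 _] := qnum_moments n.+1; rewrite /pmean E0 E1 -natr1; field.
by rewrite natr1 pnatr_eq0.
Qed.

Lemma pvar_qnum n : pvar (toF (qnum n.+1)) = (n.+1%:R ^+ 2 - 1) / 12.
Proof.
have [E0 E1 E2] := qnum_moments n.+1; rewrite /pvar pmean_qnum E0 E2 -natr1.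
by field; rewrite natr1 pnatr_eq0.
Qed.

Lemma qcatalan_moments n : (0 < n)%N ->
  pmean (toF (qcatalan n)) = n%:R * (n%:R - 1) / 2 /\
  pvar (toF (qcatalan n)) = n%:R * (n%:R ^+ 2 - 1) / 6.
Proof.
move=> n0; have := congr1 toF (qcatalan_prod n0).
rewrite rmorphM /= !rmorph_prod /= !big_add1 /=.
have q0 k : (toF (qnum k.+1)).[1] != 0.
  by have [-> _ _] := qnum_moments k.+1; rewrite pnatr_eq0.
have q0' k : (toF (qnum (n + k.+2))).[1] != 0 by rewrite addnS.
have [mA vA] := pmean_prod (index_iota 0 n.-1) (fun k => q0 k.+1).
have [mB vB] := pmean_prod (index_iota 0 n.-1) q0'.
have A0 : (\prod_(0 <= i < n.-1) toF (qnum i.+2)).[1] != 0.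
  by rewrite horner_prod prodf_seq_neq0; apply/allP => j _; rewrite q0.
have B0 : (\prod_(0 <= i < n.-1) toF (qnum (n + i.+2))).[1] != 0.
  by rewrite horner_prod prodf_seq_neq0; apply/allP => j _; rewrite q0'.
move=> E; have C0 : (toF (qcatalan n)).[1] != 0.
  by move: B0; rewrite -E hornerM mulf_eq0 negb_or => /andP[].
(* Additivity is applied to the identity without denominators; the moments of [qcatalan n] are then
   differences of two sums. *)
move: mB vB; rewrite -E pmeanM // pvarM // mA vA =>
  /(canRL (addrK _)) -> /(canRL (addrK _)) ->.
rewrite -!sumrB.
under eq_bigr do rewrite addnS !pmean_qnum.
under [in X in _ /\ X]eq_bigr do rewrite addnS !pvar_qnum.
case: n n0 {q0 q0' mA vA A0 B0 E C0} => // m _; rewrite [m.+1.-1]/=.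
(* The length [k] is kept apart from [m], so that induction changes only the range and not the
   summand; both sums are used at [k = m]. *)
have S1 k : \sum_(0 <= i < k) (((m.+1 + i.+1)%:R / 2 - i.+1%:R / 2) : F) = k%:R * m.+1%:R / 2.
  elim: k => [|k IH]; first by rewrite big_geq // !mul0r.
  by rewrite big_nat_recr //= IH !natrD -!natr1; field.
have S2 k :
  \sum_(0 <= i < k) ((((m.+1 + i.+1).+1%:R ^+ 2 - 1) / 12 - (i.+2%:R ^+ 2 - 1) / 12) : F)
  = k%:R * m.+1%:R * (m.+1%:R + k%:R + 3) / 12.
  elim: k => [|k IH]; first by rewrite big_geq // !mul0r.
  by rewrite big_nat_recr //= IH -!natr1 !natrD -!natr1; field.
by rewrite S1 S2 -!natr1; split; field.
Qed.

End qnum_moments.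

(** * Evaluation on the unit circle *)

Section complex_exponential.
Variable R : realType.
Local Open Scope complex_scope.

Definition cis (t : R) : R[i] := cos t +i* sin t.

Lemma cisD s t : cis (s + t) = cis s * cis t.
Proof. by rewrite /cis cosD sinD; simpc; congr (_ +i* _); ring. Qed.

Lemma cis0 : cis 0 = 1.
Proof. by rewrite /cis cos0 sin0. Qed.

Lemma cisX t k : cis t ^+ k = cis (k%:R * t).
Proof.
elim: k => [|k IH]; first by rewrite mul0r cis0.
by rewrite exprSr IH -cisD -natr1 mulrDl mul1r.
Qed.

Lemma cis_neq0 t : cis t != 0.
Proof.
apply/eqP => E; have := oner_neq0 R[i].
by rewrite -cis0 -(subrr t) cisD E mul0r eqxx.
Qed.

Lemma cisB1 t : cis (2 * t) - 1 = cis t * (0 +i* (2 * sin t)).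
Proof.
rewrite (_ : 2 * t = t + t); last ring.
have E := cos2Dsin2 t; rewrite /cis cosD sinD; simpc.
by congr (_ +i* _); [rewrite -[X in _ - X]E; ring | ring].
Qed.

(** With z = e^(2it), the geometric sum is (z^k - 1)/(z - 1), and [cisB1] splits numerator and
    denominator into a phase and a sine. The doubled angle avoids halves. *)
Lemma horner_qnum_cis (t : R) k : sin t != 0 ->
  (map_poly intr (qnum k)).[cis (2 * t)] =
    cis (k%:R * t - t) * (sin (k%:R * t) / sin t)%:C.
Proof.
move=> t0.
have w1 : cis (2 * t) - 1 != 0.
  rewrite cisB1 mulf_neq0 ?cis_neq0 //.
  by rewrite eq_complex /= negb_and mulf_neq0 ?orbT.
apply: (mulIf w1).
have -> : (map_poly intr (qnum k)).[cis (2 * t)] * (cis (2 * t) - 1) =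
    cis (2 * (k%:R * t)) - 1.
  rewrite (_ : 2 * (k%:R * t) = k%:R * (2 * t)); last ring.
  rewrite -[cis (k%:R * _)]cisX; elim: k => [|k IH].
    by rewrite /qnum big_ord0 rmorph0 horner0 mul0r expr0 subrr.
  rewrite /qnum big_ord_recr /= rmorphD /= map_polyXn hornerD hornerXn.
  by rewrite mulrDl IH exprSr; ring.
rewrite !cisB1 -[in LHS](subrK t (k%:R * t)) cisD subrK -!mulrA; congr (_ * _).
rewrite mulrCA; congr (_ * _).
by simpc; congr (_ +i* _); field.
Qed.

Lemma horner_qcatalan_cis n (t : R) : (0 < n)%N ->
  (forall j, (0 < j <= n)%N -> sin (j%:R * t) != 0) ->
  (map_poly intr (qcatalan n)).[cis (2 * t)] =
    cis (n%:R * (n%:R - 1) * t) *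
    (\prod_(2 <= j < n.+1) (sin ((n + j)%:R * t) / sin (j%:R * t)))%:C.
Proof.
move=> n0 s0.
have t0 : sin t != 0 by have := s0 1%N; rewrite mul1r; apply; lia.
have := congr1 (fun p => (map_poly intr p).[cis (2 * t)]) (qcatalan_prod n0).
rewrite rmorphM /= !rmorph_prod /= hornerM !horner_prod.
under eq_bigr do rewrite horner_qnum_cis //.
under [in X in _ = X]eq_bigr do rewrite horner_qnum_cis //.
move=> E.
have D0 : \prod_(2 <= j < n.+1) (cis (j%:R * t - t) * (sin (j%:R * t) / sin t)%:C) != 0.
  rewrite big_nat_cond prodf_seq_neq0; apply/allP => j _; apply/implyP => /andP[jn _].
  rewrite mulf_neq0 ?cis_neq0 // eq_complex /= negb_and mulf_neq0 ?invr_neq0 // s0 //; lia.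
apply: (mulIf D0); rewrite E {E D0}.
(* The phases (n+j-1)t and (j-1)t differ by nt for each of the n-1 indices. The total is 2t times
   the mean. *)
have -> : n%:R * (n%:R - 1) * t = \sum_(2 <= j < n.+1) (n%:R * t).
  rewrite sumr_const_nat -mulr_natr; case: n n0 {s0} => // n _.
  by rewrite subSS subn1 /= -natr1; ring.
rewrite (big_morph cis cisD cis0).
rewrite -!big_split /= big_nat [RHS]big_nat; apply: eq_bigr => j jn.
have j0 : sin (j%:R * t) != 0 by apply: s0; lia.
rewrite mulrACA -cisD -rmorphM /=; congr (cis _ * _%:C); last by field; rewrite t0.
by rewrite natrD; ring.
Qed.

(** Dividing by the phase of [horner_qcatalan_cis] centers the exponents at the mean. What remains
    is real, so its imaginary part, the sine sum, vanishes. *)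
Lemma qcatalan_cos_sin n (t : R) : (0 < n)%N ->
  (forall j, (0 < j <= n)%N -> sin (j%:R * t) != 0) ->
  let c k : R := ((qcatalan n)`_k)%:~R in
  let u k : R := 2 * t * (k%:R - n%:R * (n%:R - 1) / 2) in
  \sum_(k < size (qcatalan n)) c k * cos (u k) =
    \prod_(2 <= j < n.+1) (sin ((n + j)%:R * t) / sin (j%:R * t)) /\
  \sum_(k < size (qcatalan n)) c k * sin (u k) = 0.
Proof.
move=> n0 s0 c u; set P := \prod_(_ <= _ < _) _.
have := horner_qcatalan_cis n0 s0; rewrite -/P => E.
have {}E : \sum_(k < size (qcatalan n)) (c k)%:C * cis (u k) = P%:C.
  apply: (mulfI (cis_neq0 (n%:R * (n%:R - 1) * t))); rewrite -E.
  rewrite mulr_sumr (@horner_coef_wide _ (size (qcatalan n))); last first.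
    by rewrite size_poly.
  apply: eq_bigr => k _; rewrite coef_map /= cisX mulrCA -cisD.
  by rewrite /c rmorph_int; congr (_ * cis _); rewrite /u; field.
have reim : \sum_(k < size (qcatalan n)) (c k)%:C * cis (u k) =
  (\sum_(k < size (qcatalan n)) c k * cos (u k)) +i*
  (\sum_(k < size (qcatalan n)) c k * sin (u k)).
  elim/big_ind3: _ => //; first by move=> ? ? ? ? ? ? -> ->.
  by move=> k _; rewrite /cis; simpc.
by move: E; rewrite reim => -[].
Qed.

End complex_exponential.

(** * Exponential bounds for the sine and for quotients of sines *)

Section sine_bounds.
Variable R : realType.
Implicit Types x : R.

(** Take inverses in 1/(1-u) = 1 + u/(1-u) <= exp(u/(1-u)), and use u/(1-u) = u + u^2/(1-u) <= u +
    2u^2 for u <= 1/2. *)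
Lemma expR_sub_lower (u : R) : 0 <= u <= 1 / 2 -> expR (- u - 2 * u ^+ 2) <= 1 - u.
Proof.
move=> /andP[u0 u1].
have h : 0 < 1 - u by lra.
have E : 1 + u / (1 - u) = (1 - u)^-1 by field; lra.
have := expR_ge1Dx (u / (1 - u)); rewrite E => H.
rewrite -[leRHS]invrK -[leLHS]invrK -expRN lef_pV2 ?posrE ?invr_gt0 ?expR_gt0 //.
apply: le_trans H _; rewrite ler_expR ler_pdivrMr //; nra.
Qed.

Lemma le_of_derive (f g : R -> R) (f' g' : R -> R) :
  (forall x, is_derive x 1 f (f' x)) -> (forall x, is_derive x 1 g (g' x)) ->
  (forall x, 0 <= x -> f' x <= g' x) -> f 0 <= g 0 ->
  forall x, 0 <= x -> f x <= g x.
Proof.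
move=> df dg fg0 fg x x0.
have dh y : is_derive y (1 : R) (fun z => g z - f z) (g' y - f' y).
  by have := df y; have := dg y => ? ?; exact: is_deriveB.
have ch : {within `[0, x], continuous (fun z => g z - f z)}.
  apply: continuous_subspaceT => y; apply: differentiable_continuous.
  by apply/derivable1_diffP; have [] := dh y.
have [c c0x E] := MVT_segment x0 (fun y _ => dh y) ch.
rewrite -subr_ge0.
apply: le_trans (_ : g 0 - f 0 <= _); first by rewrite subr_ge0.
rewrite -subr_ge0 E mulr_ge0 ?subr_ge0 ?fg0 //.
by move: c0x; rewrite in_itv /= => /andP[].
Qed.

(** Starting from cos <= 1, each Taylor bound is the previous one integrated from 0, by
    [le_of_derive]. *)
Lemma sin_cos_bounds x : 0 <= x ->
  [/\ sin x <= x, 1 - x ^+ 2 / 2 <= cos x, x - x ^+ 3 / 6 <= sin x,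
      cos x <= 1 - x ^+ 2 / 2 + x ^+ 4 / 24 &
      sin x <= x - x ^+ 3 / 6 + x ^+ 5 / 120].
Proof.
have dX (k : nat) (a y : R) : is_derive y (1 : R) (fun z : R => z ^+ k.+1 * a)
    (k.+1%:R * y ^+ k * a).
  have -> : (fun z : R => z ^+ k.+1 * a) = a \*: (@id R ^+ k.+1).
    by apply/funext => z; rewrite /= fctE mulrC.
  apply: is_derive_eq; rewrite /GRing.scale /= mulr1; ring.
have dP2 (y : R) : is_derive y (1 : R) (fun z : R => 1 - z ^+ 2 / 2) (- y).
  by have := dX 1%N 2^-1 y => d; apply: is_derive_eq; field.
have dP3 (y : R) : is_derive y (1 : R) (fun z : R => z - z ^+ 3 / 6) (1 - y ^+ 2 / 2).
  by have := dX 2%N 6^-1 y => d; apply: is_derive_eq; field.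
have dP4 (y : R) : is_derive y (1 : R) (fun z : R => 1 - z ^+ 2 / 2 + z ^+ 4 / 24)
    (- (y - y ^+ 3 / 6)).
  by have := dP2 y => d; have := dX 3%N 24^-1 y => d'; apply: is_derive_eq; field.
have dP5 (y : R) : is_derive y (1 : R) (fun z : R => z - z ^+ 3 / 6 + z ^+ 5 / 120)
    (1 - y ^+ 2 / 2 + y ^+ 4 / 24).
  by have := dP3 y => d; have := dX 4%N 120^-1 y => d'; apply: is_derive_eq; field.
have B1 (y : R) : 0 <= y -> sin y <= y.
  apply: (le_of_derive (@is_derive_sin R) (fun y => is_derive_id y 1)); last by rewrite sin0.
  by move=> z _; exact: cos_le1.
have B2 (y : R) : 0 <= y -> 1 - y ^+ 2 / 2 <= cos y.
  apply: (le_of_derive dP2 (@is_derive_cos R)) => [z /B1|]; first by rewrite lerN2.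
  by rewrite expr0n /= mul0r subr0 cos0.
have B3 (y : R) : 0 <= y -> y - y ^+ 3 / 6 <= sin y.
  apply: (le_of_derive dP3 (@is_derive_sin R) B2).
  by rewrite expr0n /= mul0r subr0 sin0.
have B4 (y : R) : 0 <= y -> cos y <= 1 - y ^+ 2 / 2 + y ^+ 4 / 24.
  apply: (le_of_derive (@is_derive_cos R) dP4) => [z /B3|]; first by rewrite lerN2.
  by rewrite !expr0n /= !mul0r subr0 addr0 cos0.
have B5 (y : R) : 0 <= y -> sin y <= y - y ^+ 3 / 6 + y ^+ 5 / 120.
  apply: (le_of_derive (@is_derive_sin R) dP5 B4).
  by rewrite !expr0n /= !mul0r subr0 addr0 sin0.
move=> x0; split; auto.
Qed.

(** The true quartic corrections are at most x^4/18 and x^4/120; the coefficient 1 is generous,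
    since only the order of the error matters later. *)
Lemma sin_expR_bounds x : 0 < x <= 1 ->
  x * expR (- (x ^+ 2 / 6) - x ^+ 4) <= sin x <= x * expR (- (x ^+ 2 / 6) + x ^+ 4).
Proof.
move=> /andP[x0 x1].
have [_ _ L _ U] := sin_cos_bounds (ltW x0).
apply/andP; split.
  apply: le_trans (_ : x * (1 - x ^+ 2 / 6) <= _); last by move: L; congr (_ <= _); ring.
  rewrite ler_pM2l //; apply: le_trans (expR_sub_lower (u := x ^+ 2 / 6) _); last by nra.
  rewrite ler_expR -subr_ge0.
  rewrite [leRHS](_ : _ = 17 / 18 * x ^+ 4); last by field.
  by rewrite mulr_ge0 // exprn_ge0 // ltW.
apply: le_trans U _; apply: le_trans (_ : x * (1 + (- (x ^+ 2 / 6) + x ^+ 4)) <= _).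
  rewrite -subr_ge0 [leRHS](_ : _ = 119 / 120 * x ^+ 5); last by field.
  by rewrite mulr_ge0 // exprn_ge0 // ltW.
by rewrite ler_pM2l // expR_ge1Dx.
Qed.

(** The errors a^4 and b^4 are both replaced by d^4, so that one [d] serves every factor of the
    product. *)
Lemma sin_ratio_bounds (a b d : R) : 0 < b <= a -> a <= d -> d <= 1 ->
  [/\ 0 < sin b,
  a / b * expR (- ((a ^+ 2 - b ^+ 2) / 6) - 2 * d ^+ 4) <= sin a / sin b &
  sin a / sin b <= a / b * expR (- ((a ^+ 2 - b ^+ 2) / 6) + 2 * d ^+ 4)].
Proof.
move=> /andP[b0 ba] ad d1.
have a01 : 0 < a <= 1 by apply/andP; split; lra.
have b01 : 0 < b <= 1 by apply/andP; split; lra.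
have /andP[a_lo a_hi] := sin_expR_bounds a01.
have /andP[b_lo b_hi] := sin_expR_bounds b01.
have [a0 _] := andP a01.
have sb0 : 0 < sin b by apply: lt_le_trans b_lo; rewrite mulr_gt0 ?expR_gt0.
have a4 : a ^+ 4 <= d ^+ 4 by rewrite lerXn2r ?nnegrE //; lra.
have b4 : b ^+ 4 <= d ^+ 4 by rewrite lerXn2r ?nnegrE //; lra.
split=> //.
  rewrite ler_pdivlMr //; apply: le_trans a_lo.
  apply: le_trans (ler_wpM2l _ b_hi) _.
    by rewrite mulr_ge0 ?expR_ge0 // divr_ge0 // ltW.
  rewrite [leLHS](_ : _ = a * (expR (- ((a ^+ 2 - b ^+ 2) / 6) - 2 * d ^+ 4) *
    expR (- (b ^+ 2 / 6) + b ^+ 4)));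
    last by field; lra.
  by rewrite -expRD ler_pM2l // ler_expR; lra.
rewrite ler_pdivrMr //; apply: le_trans a_hi _.
apply: le_trans (ler_wpM2l _ b_lo); last first.
  by rewrite mulr_ge0 ?expR_ge0 // divr_ge0 // ltW.
rewrite [leRHS](_ : _ = a * (expR (- ((a ^+ 2 - b ^+ 2) / 6) + 2 * d ^+ 4) *
    expR (- (b ^+ 2 / 6) - b ^+ 4)));
  last by field; lra.
by rewrite -expRD ler_pM2l // ler_expR; lra.
Qed.

End sine_bounds.

(** * Two-sided bounds for the normalized product of sine quotients *)

Section catalan_product.
Variable R : realType.

Lemma catalan_prod n : (0 < n)%N ->
  (catalan n)%:R = \prod_(2 <= j < n.+1) ((n + j)%:R / j%:R) :> R.
Proof.
move=> n0; have := congr1 (fun p : {poly int} => p.[1]%:~R : R) (qcatalan_prod n0).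
rewrite /= hornerM qcatalan1 rmorphM !horner_prod /= !rmorph_prod /= rmorph_nat.
under eq_bigr do rewrite qnum1 rmorph_nat.
under [in X in _ = X]eq_bigr do rewrite qnum1 rmorph_nat.
move=> E; rewrite prodf_div -E mulfK //.
rewrite big_nat_cond prodf_seq_neq0; apply/allP => j _; apply/implyP => /andP[jn _].
by rewrite pnatr_eq0; lia.
Qed.

Lemma catalan_gt0 n : (0 < n)%N -> 0 < (catalan n)%:R :> R.
Proof.
move=> n0; rewrite catalan_prod // big_nat_cond; apply: prodr_gt0 => j /andP[jn _].
by rewrite divr_gt0 ?ltr0n //; lia.
Qed.

(** At the frequency 2t, [e] is the Gaussian exponent Var (2t)^2/2. The remainder [r] allows an
    error 2d^4 for each of at most n factors, where d = 2nt bounds all the angles. *)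
Lemma sin_prod_bounds n (t : R) : (0 < n)%N -> 0 < t -> 2 * n%:R * t <= 1 ->
  let e := n%:R * (n%:R ^+ 2 - 1) / 3 * t ^+ 2 in
  let r := 2 * n%:R * (2 * n%:R * t) ^+ 4 in
  let p := (\prod_(2 <= j < n.+1) (sin ((n + j)%:R * t) / sin (j%:R * t))) / (catalan n)%:R in
  expR (- e - r) <= p /\ p <= expR (- e + r).
Proof.
move=> n0 t0 nt1 e r p; set d := 2 * n%:R * t.
have n1 : 1 <= n%:R :> R by rewrite ler1n.
pose u j : R := ((n + j)%:R * t) ^+ 2 - (j%:R * t) ^+ 2.
have U : \sum_(2 <= j < n.+1) u j / 6 = e.
  (* The closed form is proved with a free upper bound and from [j = 1], whose term is then
     removed. *)
  have S k : \sum_(1 <= j < k.+1) u j / 6 =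
      (k%:R * n%:R ^+ 2 + n%:R * k%:R * (k%:R + 1)) / 6 * t ^+ 2.
    elim: k => [|k IH]; first by rewrite big_geq // !(mul0r, mulr0) addr0 !mul0r.
    by rewrite big_nat_recr //= IH /u natrD -!natr1; field.
  have := S n; rewrite big_ltn // => /(canRL (addKr _)) ->.
  by rewrite /u /e natrD; field.
have D4 : 0 <= 2 * d ^+ 4 by rewrite mulr_ge0 // exprn_ge0 // /d; nra.
have Rr : \sum_(2 <= j < n.+1) (2 * d ^+ 4) <= r.
  rewrite sumr_const_nat /r -/d -[leLHS]mulr_natr.
  rewrite [leRHS](_ : _ = 2 * d ^+ 4 * n%:R); last ring.
  by apply: ler_wpM2l => //; rewrite ler_nat; lia.
have B j : (2 <= j < n.+1)%N -> [/\ 0 < sin (j%:R * t),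
    (n + j)%:R / j%:R * expR (- (u j / 6) - 2 * d ^+ 4) <=
      sin ((n + j)%:R * t) / sin (j%:R * t) &
    sin ((n + j)%:R * t) / sin (j%:R * t) <=
      (n + j)%:R / j%:R * expR (- (u j / 6) + 2 * d ^+ 4)].
  move=> /andP[j2 jn]; rewrite ltnS in jn.
  have j0 : 2 <= j%:R :> R by rewrite ler_nat.
  have jn' : j%:R <= n%:R :> R by rewrite ler_nat.
  rewrite (_ : (n + j)%:R / j%:R = (n + j)%:R * t / (j%:R * t)); last first.
    by field; rewrite !gt_eqF //; lra.
  apply: sin_ratio_bounds => //; rewrite natrD /d; nra.
have c0 : 0 < (catalan n)%:R :> R by exact: catalan_gt0.
rewrite {}/p ler_pdivlMr // ler_pdivrMr // catalan_prod // ![expR _ * _]mulrC; split.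
  apply: le_trans (_ : \prod_(2 <= j < n.+1)
     ((n + j)%:R / j%:R * expR (- (u j / 6) - 2 * d ^+ 4)) <= _).
    rewrite [leRHS]big_split /= -expR_sum.
    rewrite ler_pM2l ?ler_expR; last by rewrite -catalan_prod.
    by rewrite sumrB sumrN U; lra.
  rewrite big_nat [leRHS]big_nat; apply: ler_prod => j /B[s0 -> _].
  by rewrite mulr_ge0 ?expR_ge0 // divr_ge0.
apply: le_trans (_ : \prod_(2 <= j < n.+1)
     ((n + j)%:R / j%:R * expR (- (u j / 6) + 2 * d ^+ 4)) <= _).
  rewrite big_nat [leRHS]big_nat; apply: ler_prod => j /B[s0 l ->].
  rewrite andbT; apply: le_trans l.
  by rewrite mulr_ge0 ?expR_ge0 // divr_ge0.
rewrite [leLHS]big_split /= -expR_sum.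
rewrite ler_pM2l ?ler_expR; last by rewrite -catalan_prod.
by rewrite big_split /= sumrN U; lra.
Qed.

End catalan_product.

(** * Convergence of characteristic functions implies convergence in distribution *)

Section trig_polynomials.
Variable R : realType.

(** The phase [b] makes one generator produce sines, cosines and constants. Products then stay in
    the class by the product-to-sum formula, and convergence of integrals has to be known on this
    generator only. *)
Inductive trig_poly : (R -> R) -> Prop :=
| trig_cos a b : trig_poly (fun x => cos (a * x + b))
| trig_add f g : trig_poly f -> trig_poly g -> trig_poly (fun x => f x + g x)
| trig_scale c f : trig_poly f -> trig_poly (fun x => c * f x).

Lemma eq_trig_poly f g : f =1 g -> trig_poly f -> trig_poly g.
Proof. by move=> /funext ->. Qed.

Lemma trig_cst c : trig_poly (fun=> c).
Proof.
apply: eq_trig_poly (trig_scale c (trig_cos 0 0)) => x.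
by rewrite mul0r addr0 cos0 mulr1.
Qed.

Lemma trig_mul f g : trig_poly f -> trig_poly g -> trig_poly (fun x => f x * g x).
Proof.
move=> pf pg; elim: pf => [a b|f1 f2 _ p1 _ p2|c f1 _ p1]; last first.
- by apply: eq_trig_poly (trig_scale c p1) => x; rewrite mulrA.
- by apply: eq_trig_poly (trig_add p1 p2) => x; rewrite mulrDl.
elim: pg => [a' b'|g1 g2 _ p1 _ p2|c g1 _ p1]; last first.
- by apply: eq_trig_poly (trig_scale c p1) => x; rewrite mulrCA.
- by apply: eq_trig_poly (trig_add p1 p2) => x; rewrite mulrDr.
apply: eq_trig_poly (trig_scale (1 / 2)
  (trig_add (trig_cos (a + a') (b + b')) (trig_cos (a - a') (b - b')))) => x.
have -> : (a + a') * x + (b + b') = (a * x + b) + (a' * x + b') by ring.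
have -> : (a - a') * x + (b - b') = (a * x + b) - (a' * x + b') by ring.
by rewrite cosD cosB; field.
Qed.

Lemma trig_poly_continuous f : trig_poly f -> continuous f.
Proof.
elim=> [a b|g h _ cg _ ch|c g _ cg] x.
- apply: (@continuous_comp _ _ _ (fun x => a * x + b) cos); last exact: continuous_cos.
  by apply: cvgD; [apply: cvgMl_tmp; exact: cvg_id | exact: cvg_cst].
- by apply: cvgD; [exact: cg | exact: ch].
- by apply: cvgMl_tmp; exact: cg.
Qed.

Lemma trig_poly_bounded f : trig_poly f -> exists M, forall x, `|f x| <= M.
Proof.
elim=> [a b|g h _ [M gM] _ [N hN]|c g _ [M gM]].
- by exists 1 => x; rewrite ler_norml cos_geN1 cos_le1.
- by exists (M + N) => x; apply: le_trans (ler_normD _ _) _; exact: lerD.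
- by exists (`|c| * M) => x; rewrite normrM ler_wpM2l.
Qed.

(* On [-1, 1] this odd cubic has fixed points -1, 0, 1, of which 0 is
   repelling: its iterates converge to the sign function. *)
Definition sharpen (v : R) := (3 * v - v ^+ 3) / 2.

Lemma sharpenN v : sharpen (- v) = - sharpen v.
Proof. by rewrite /sharpen; ring. Qed.

Lemma iter_sharpenN m v : iter m sharpen (- v) = - iter m sharpen v.
Proof. by elim: m => //= m ->; rewrite sharpenN. Qed.

Lemma iter_sharpen_itv m v : -1 <= v <= 1 -> -1 <= iter m sharpen v <= 1.
Proof.
move=> v1; elim: m => //= m; set w := iter m _ _ => /andP[w0 w1]; rewrite /sharpen.
(* [H1] and [H2] are the factored forms of 2(1 + [sharpen w]) and 2(1 - [sharpen w]). *)
have H1 : 0 <= (1 + w) ^+ 2 * (2 - w) by rewrite mulr_ge0 ?sqr_ge0 //; lra.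
have H2 : 0 <= (1 - w) ^+ 2 * (2 + w) by rewrite mulr_ge0 ?sqr_ge0 //; lra.
by apply/andP; split; lra.
Qed.

(** By the factorization [E], the distance to 1 shrinks at each step by 1 - w/2 - w^2/2, which is at
    most 1 - k/2 as long as w stays above [k]; this invariant is carried along in the induction. *)
Lemma iter_sharpen_lower m k v : 0 <= k -> k <= v -> v <= 1 ->
  1 - (1 - k / 2) ^+ m <= iter m sharpen v.
Proof.
move=> k0 kv v1.
suff : 1 - (1 - k / 2) ^+ m <= iter m sharpen v /\ k <= iter m sharpen v <= 1 by case.
elim: m => [|m [IH /andP[w0 w1]]] /=.
  by rewrite expr0 subrr kv v1 (le_trans k0 kv).
move: IH w0 w1; set w := iter m _ _ => IH w0 w1.
have P : 0 <= (1 - k / 2) ^+ m by rewrite exprn_ge0 //; lra.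
rewrite exprS; move: P IH; set P := _ ^+ m => P0 IH.
have E : 1 - sharpen w = (1 - w) * (1 - w / 2 - w ^+ 2 / 2) by rewrite /sharpen; field.
split.
  rewrite -subr_ge0 [leRHS](_ : _ = (1 - k / 2) * P - (1 - sharpen w)); last by ring.
  rewrite E subr_ge0; apply: le_trans (_ : (1 - w) * (1 - k / 2) <= _); last by nra.
  by apply: ler_wpM2l; nra.
(* This is 2([sharpen w] - w): on [0, 1] the cubic does not decrease its argument, so [k] remains a
   lower bound. *)
have H1 : 0 <= w * ((1 - w) * (1 + w)) by rewrite !mulr_ge0 //; lra.
have H2 : 0 <= (1 - w) ^+ 2 * (2 + w) by rewrite mulr_ge0 ?sqr_ge0 //; lra.
by apply/andP; split; rewrite /sharpen; lra.
Qed.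

Lemma trig_poly_iter_sharpen m f : trig_poly f ->
  trig_poly (fun x => iter m sharpen (f x)).
Proof.
move=> pf; elim: m => //= m IH.
apply: eq_trig_poly (trig_add (trig_scale (3 / 2) IH)
  (trig_scale (- 1 / 2) (trig_mul IH (trig_mul IH IH)))) => x.
by rewrite /sharpen; field.
Qed.

(** A trigonometric polynomial cannot follow the step on the whole line. It does so on [-A, A]
    outside a window of radius [k] around [a]; elsewhere only 0 <= G <= 1 is retained. *)
Lemma trig_poly_step (a k e A : R) : 0 < k -> 0 < e ->
  exists G, [/\ trig_poly G, forall y, 0 <= G y <= 1,
    forall y, `|y| <= A -> y <= a - k -> 1 - e <= G y &
    forall y, `|y| <= A -> a + k <= y -> G y <= e].
Proof.
(* For |y| <= A this scale puts (y - a)/M in [-1, 1], where the sine has the sign of its argument;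
   the summand [k] makes M positive and k/M at most 1. *)
move=> k0 e0; pose M := `|A| + `|a| + k.
have M0 : 0 < M by have := normr_ge0 A; have := normr_ge0 a; rewrite /M; lra.
have kM : 0 < k / M by rewrite divr_gt0.
have kM1 : k / M <= 1.
  by rewrite ler_pdivrMr // mul1r /M; have := normr_ge0 A; have := normr_ge0 a; lra.
(* Outside the window |sin((y - a)/M)| >= k/M/2 by [sinM]; [iter_sharpen_lower] halves this once
   more in its ratio. *)
have [m em] : exists m : nat, (1 - k / M / 2 / 2) ^+ m <= e.
  have q1 : `|1 - k / M / 2 / 2| < 1 by rewrite ger0_norm; lra.
  have := cvg_expr q1; move=> /cvgrPdist_le /(_ e e0) [m _ mP].
  exists m; have := mP m (leqnn m); rewrite /= sub0r normrN; apply: le_trans; exact: ler_norm.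
pose S y := sin ((y - a) / M).
have pS : trig_poly S.
  apply: eq_trig_poly (trig_cos M^-1 (- a / M - pi / 2)) => y.
  by rewrite /S -cosBpihalf; congr cos; ring.
have S1 y : -1 <= S y <= 1 by rewrite sin_geN1 sin_le1.
have sinM u : k / M <= u -> u <= 1 -> k / M / 2 <= sin u.
  move=> u0 u1; have [_ _ + _ _] := sin_cos_bounds (le_trans (ltW kM) u0).
  apply: le_trans; nra.
have yaM y : `|y| <= A -> `|y - a| <= M.
  move=> yA; apply: le_trans (ler_normB _ _) _.
  by rewrite /M; have := ler_norm A; lra.
have P : 1 - e <= 1 - (1 - k / M / 2 / 2) ^+ m by lra.
have kM0 : 0 <= k / M / 2 by lra.
pose G y := (1 - iter m sharpen (S y)) / 2.
exists G; split.
- apply: eq_trig_poly (trig_add (trig_cst (1 / 2))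
    (trig_scale (- 1 / 2) (trig_poly_iter_sharpen m pS))) => y.
  by rewrite /G; field.
- move=> y; have /andP[] := iter_sharpen_itv m (S1 y).
  by rewrite /G; set w := iter _ _ _; lra.
- move=> y yA ya; have sS : k / M / 2 <= sin ((a - y) / M).
    apply: sinM; first by rewrite ler_pM2r ?invr_gt0 //; lra.
    rewrite ler_pdivrMr // mul1r; apply: le_trans (yaM _ yA).
    by rewrite distrC ler_norm.
  have SE : S y = - sin ((a - y) / M) by rewrite -sinN -mulNr opprB.
  have := iter_sharpen_lower m kM0 sS (sin_le1 _).
  by rewrite /G SE iter_sharpenN; set w := iter _ _ _; lra.
- move=> y yA ya; have sS : k / M / 2 <= S y.
    apply: sinM; first by rewrite ler_pM2r ?invr_gt0 //; lra.
    by rewrite ler_pdivrMr // mul1r; apply: le_trans (yaM _ yA); rewrite ler_norm.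
  have := iter_sharpen_lower m kM0 sS (sin_le1 _).
  by rewrite /G; set w := iter _ _ _; lra.
Qed.

End trig_polynomials.

(** * Distribution functions compared with integrals of trigonometric polynomials *)

Section levy_continuity.
Variable R : realType.
Implicit Types mu : probability (measurableTypeR R) R.

Lemma bounded_integrable mu (f : R -> R) M :
  measurable_fun setT f -> (forall x, `|f x| <= M) -> mu.-integrable setT (EFin \o f).
Proof.
move=> mf fM; apply: measurable_bounded_integrable => //.
  by rewrite ltey_eq fin_num_measure.
by exists M; split; [exact: num_real | move=> N MN x _ /=; apply: le_trans (fM x) (ltW MN)].
Qed.

Lemma trig_poly_integrable mu (f : R -> R) : trig_poly f -> mu.-integrable setT (EFin \o f).
Proof.
move=> pf; have [M fM] := trig_poly_bounded pf.
apply: bounded_integrable fM; apply: continuous_measurable_fun.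
exact: trig_poly_continuous.
Qed.

Let tail (A : R) : set R := [set x | A < `|x|].

Lemma measurable_tail A : measurable (tail A).
Proof.
have := @normr_measurable R setT measurableT `]A, +oo[%classic (measurable_itv _).
rewrite setTI; congr measurable; apply/seteqP; split=> x /=.
  by rewrite in_itv /= andbT.
by rewrite in_itv /= andbT.
Qed.

Lemma probability_tail mu (e : R) : 0 < e -> exists A, fine (mu (tail A)) <= e.
Proof.
move=> e0; pose F (n : nat) := tail n%:R.
have capF : \bigcap_n F n = set0.
  rewrite -subset0 => x xF; have := xF (Num.truncn `|x|).+1 I.
  by rewrite /F /tail /= ltNge ltW // truncnS_gt.
have : mu \o F @ \oo --> mu (\bigcap_n F n).
  apply: nonincreasing_cvg_mu => //=.
  - by rewrite ltey_eq fin_num_measure //; exact: measurable_tail.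
  - by move=> i; exact: measurable_tail.
  - by rewrite capF.
  - move=> m n mn; apply/subsetPset => x; rewrite /F /tail /=; apply: le_lt_trans.
    by rewrite ler_nat.
rewrite capF measure0 => /fine_cvgP[_] /cvgrPdist_le /(_ e e0) [n _ nP].
exists n%:R; have := nP n (leqnn n); rewrite /= sub0r normrN; apply: le_trans.
exact: ler_norm.
Qed.

Section sandwich.
Variables (mu : probability (measurableTypeR R) R) (G : R -> R) (a e A : R).
Hypotheses (pG : trig_poly G) (G01 : forall y, 0 <= G y <= 1) (e0 : 0 <= e).

Let ind_int (B : set R) : measurable B -> mu.-integrable setT (EFin \o (\1_B : R -> R)).
Proof. by move=> mB; apply: integrable_indic. Qed.

Let Rind (B : set R) : measurable B -> \int[mu]_x (\1_B x) = fine (mu B).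
Proof. by move=> mB; rewrite /Rintegral integral_indic // setIT. Qed.

Let addR_int (f g : R -> R) : mu.-integrable setT (EFin \o f) ->
  mu.-integrable setT (EFin \o g) -> mu.-integrable setT (EFin \o (fun y => f y + g y)).
Proof. by move=> i j; have := integrableD measurableT i j; exact: eq_integrable. Qed.

Let slack_int : mu.-integrable setT (EFin \o (fun y => e + \1_(tail A) y)).
Proof.
apply: (@addR_int (cst e)); first exact: finite_measure_integrable_cst.
apply: ind_int; exact: measurable_tail.
Qed.

Let slackE (f : R -> R) : mu.-integrable setT (EFin \o f) ->
  \int[mu]_y (f y + (e + \1_(tail A) y)) = \int[mu]_y f y + (e + fine (mu (tail A))).
Proof.
move=> intf; rewrite RintegralD //; congr (_ + _).
rewrite (@RintegralD _ _ _ _ _ (cst e)) //.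
- rewrite Rintegral_cst // Rind; last exact: measurable_tail.
  by rewrite [X in e * fine X](_ : _ = 1%E) ?mulr1 //; exact: probability_setT.
- exact: finite_measure_integrable_cst.
- apply: ind_int; exact: measurable_tail.
Qed.

(** The indicator of y <= a is bounded pointwise by G + e + [\1_(tail A)]: off the tail by [G1], on
    it because an indicator is at most 1. Integration against [mu] gives the claim; [trig_le_cdf] is
    the mirror image. *)
Lemma cdf_le_trig (G1 : forall y, `|y| <= A -> y <= a -> 1 - e <= G y) :
  fine (mu `]-oo, a]%classic) <= \int[mu]_y G y + (e + fine (mu (tail A))).
Proof.
have iG := trig_poly_integrable mu pG.
rewrite -slackE // -Rind //; apply: le_Rintegral => //; first exact: ind_int.
  exact: addR_int.
move=> y _; rewrite !indicE; have /andP[g0 g1] := G01 y.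
have [At|At] := boolP (y \in (tail A : set (measurableTypeR R))).
  apply: (@le_trans _ _ 1); first by rewrite (ler_nat _ _ 1) leq_b1.
  by rewrite addrA lerDr addr_ge0.
have yA : `|y| <= A by rewrite leNgt; apply/negP => yA; move/negP: At; apply; exact/mem_set.
rewrite addr0; have [|_] := boolP (y \in (`]-oo, a]%classic : set (measurableTypeR R)));
  last by rewrite addr_ge0.
by rewrite inE /= in_itv /= => /(G1 _ yA); rewrite lerBlDr.
Qed.

Lemma trig_le_cdf (G1 : forall y, `|y| <= A -> a < y -> G y <= e) :
  \int[mu]_y G y <= fine (mu `]-oo, a]%classic) + (e + fine (mu (tail A))).
Proof.
have iG := trig_poly_integrable mu pG.
have iI : mu.-integrable setT (EFin \o (\1_(`]-oo, a]%classic) : R -> R)) by exact: ind_int.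
rewrite -[X in _ <= X + _]Rind // -slackE //; apply: le_Rintegral => //.
  exact: addR_int.
move=> y _; rewrite !indicE; have /andP[g0 g1] := G01 y.
have [At|At] := boolP (y \in (tail A : set (measurableTypeR R))).
  by apply: le_trans g1 _; rewrite addrA lerDr addr_ge0.
have yA : `|y| <= A by rewrite leNgt; apply/negP => yA; move/negP: At; apply; exact/mem_set.
rewrite addr0; have [_|] := boolP (y \in (`]-oo, a]%classic : set (measurableTypeR R))).
  by apply: le_trans g1 _; rewrite lerDl.
by rewrite notin_setE /= in_itv /= add0r => /negP; rewrite -ltNge => /(G1 _ yA).
Qed.

End sandwich.

End levy_continuity.

Section levy_theorem.
Variable R : realType.

Lemma trig_poly_cvg (mu_ : nat -> probability (measurableTypeR R) R)
    (mu : probability (measurableTypeR R) R) :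
  (forall a b, \int[mu_ n]_x cos (a * x + b) @[n --> \oo] --> \int[mu]_x cos (a * x + b)) ->
  forall f, trig_poly f -> \int[mu_ n]_x f x @[n --> \oo] --> \int[mu]_x f x.
Proof.
move=> cvg_cos f; elim=> [a b|g h pg IHg ph IHh|c g pg IHg]; first exact: cvg_cos.
- under eq_fun do rewrite RintegralD ?trig_poly_integrable //.
  by rewrite RintegralD ?trig_poly_integrable //; exact: cvgD.
- under eq_fun do rewrite RintegralZl ?trig_poly_integrable //.
  by rewrite RintegralZl ?trig_poly_integrable //; exact: cvgMl_tmp.
Qed.

(** Tightness is the part that handles |y| > A, where the approximating steps are uncontrolled. *)
Lemma levy_continuity (mu_ : nat -> probability (measurableTypeR R) R)
    (mu : probability (measurableTypeR R) R) :
  (forall a b, \int[mu_ n]_x cos (a * x + b) @[n --> \oo] --> \int[mu]_x cos (a * x + b)) ->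
  (forall e : R, 0 < e -> exists A : R,
    \forall n \near \oo, fine (mu_ n [set x | A < `|x|]) <= e) ->
  forall x : R, {for x, continuous (fun y : R => mu `]-oo, y]%classic)} ->
  mu_ n `]-oo, x]%classic @[n --> \oo] --> mu `]-oo, x]%classic.
Proof.
move=> cvg_cos tight x cx.
have fin (nu : probability (measurableTypeR R) R) (B : set R) :
  measurable B -> nu B \is a fin_num by move=> mB; exact: fin_num_measure.
rewrite -(fineK (fin mu _ (measurable_itv _))).
apply: cvg_EFin; first by apply: nearW => n; exact: fin.
(* Six errors of size [e'] add up on each side: approximation and tail, once for [mu_ n] and once
   for [mu], then convergence of the integrals and continuity at [x]. Eight leaves slack. *)
apply/cvgrPdist_le => e e0; pose e' := e / 8.
have e'0 : 0 < e' by rewrite divr_gt0.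
have {}cx : fine (mu `]-oo, y]%classic) @[y --> x] --> fine (mu `]-oo, x]%classic).
  by apply: fine_cvg; rewrite fineK ?fin //; exact: cx.
have [k k0 kP] : exists2 k : R, 0 < k & forall y, `|x - y| <= k ->
    `|fine (mu `]-oo, x]%classic) - fine (mu `]-oo, y]%classic)| <= e'.
  have /cvgrPdist_le /(_ _ e'0) /nbhs_ballP[r /= r0 rP] := cx.
  exists (r / 2); first by rewrite divr_gt0.
  by move=> y xy; apply: rP; rewrite /ball /=; lra.
have [A1 A1P] := tight _ e'0.
have [A2 A2P] := probability_tail mu e'0.
pose A := Num.max A1 A2.
have tailS (nu : probability (measurableTypeR R) R) B : B <= A ->
    fine (nu [set x | A < `|x|]) <= fine (nu [set x | B < `|x|]).
  move=> BA; apply: fine_le; [by apply: fin; exact: measurable_tail|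
    by apply: fin; exact: measurable_tail|].
  by apply: le_measure; rewrite ?inE; [exact: measurable_tail|exact: measurable_tail|
    move=> y /=; exact: le_lt_trans].
have tailmu : fine (mu [set x | A < `|x|]) <= e'.
  by apply: le_trans (tailS _ A2 _) A2P; rewrite le_max lexx orbT.
have k20 : 0 < k / 2 by rewrite divr_gt0.
(* [Gp] falls between x and x + k, and [Gm] between x - k and x. Each is compared with [mu_ n] at
   [x] and with [mu] at the far end of its window. *)
have [Gp [pGp Gp01 Gp1 Gp0]] := trig_poly_step (x + k / 2) A k20 e'0.
have [Gm [pGm Gm01 Gm1 Gm0]] := trig_poly_step (x - k / 2) A k20 e'0.
have cp := trig_poly_cvg cvg_cos pGp; have cm := trig_poly_cvg cvg_cos pGm.
move/cvgrPdist_le : cp => /(_ _ e'0) cp; move/cvgrPdist_le : cm => /(_ _ e'0) cm.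
near=> n.
have tailn : fine (mu_ n [set x | A < `|x|]) <= e'.
  by apply: le_trans (tailS _ A1 _) _; [rewrite le_max lexx | near: n].
have cpn : `|\int[mu]_x Gp x - \int[mu_ n]_x Gp x| <= e' by near: n.
have cmn : `|\int[mu]_x Gm x - \int[mu_ n]_x Gm x| <= e' by near: n.
have U1 := cdf_le_trig (mu_ n) (a := x) pGp Gp01 (ltW e'0) (A := A).
have L1 := trig_le_cdf (mu_ n) (a := x) pGm Gm01 (ltW e'0) (A := A).
have U2 := trig_le_cdf mu (a := x + k) pGp Gp01 (ltW e'0) (A := A).
have L2 := cdf_le_trig mu (a := x - k) pGm Gm01 (ltW e'0) (A := A).
have {}U1 := U1 (fun y yA yx => Gp1 y yA (ltac:(lra))).
have {}U2 := U2 (fun y yA yx => Gp0 y yA (ltac:(lra))).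
have {}L1 := L1 (fun y yA yx => Gm0 y yA (ltac:(lra))).
have {}L2 := L2 (fun y yA yx => Gm1 y yA (ltac:(lra))).
have C1 := kP (x + k) (ltac:(rewrite opprD addNKr normrN ger0_norm; lra)).
have C2 := kP (x - k) (ltac:(rewrite opprB addrC subrK ger0_norm; lra)).
move: C1 C2 cpn cmn; rewrite !ler_norml => /andP[? ?] /andP[? ?] /andP[? ?] /andP[? ?].
have e8 : e = 8 * e' by rewrite /e'; field.
by rewrite /= e8; apply/andP; split; lra.
Unshelve. all: by end_near. Qed.

End levy_theorem.

(** * The characteristic function of the normal law *)

Section whole_line_FTC.
Variable R : realType.
Local Notation mu := (@lebesgue_measure R).

(** The integral over [-n, n] is a boundary difference, and |h| dominates the truncations of h. This
    provides integration by parts on the line. *)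
Lemma Rintegral_derive_eq0 (H h : R -> R) :
  (forall x, is_derive x (1 : R) H (h x)) -> continuous h ->
  mu.-integrable setT (EFin \o h) ->
  (H n%:R - H (- n%:R)) @[n --> \oo] --> (0 : R) ->
  \int[mu]_x h x = 0.
Proof.
move=> dH ch ih H0.
pose f_ n x := ((h \_ `[- n%:R, n%:R]) x)%:E.
have mh : measurable_fun setT (EFin \o h) by case/integrableP: ih.
have cH : continuous H.
  move=> x; apply: differentiable_continuous.
  by apply/derivable1_diffP; have [] := dH x.
have mf n : measurable_fun setT (f_ n).
  apply/measurable_EFinP; apply/(measurable_restrictT _ _).1 => //.
  by apply: measurable_funTS; exact/measurable_EFinP.
have ff : {ae mu, forall x : R, [set: R] x -> f_ ^~ x @ \oo --> (EFin \o h) x}.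
  apply: aeW => x _; apply: cvg_near_cst; exists (Num.truncn `|x|).+1 => // n /= xn.
  rewrite /f_ patchE ifT // inE /= in_itv /= -ler_norml ltW //.
  by apply: lt_le_trans (truncnS_gt _) _; rewrite ler_nat.
have ig : mu.-integrable setT (fun x => `|(EFin \o h) x|%E) by exact: integrable_abse.
have fg : {ae mu, forall (x : R) n, [set: R] x -> (`|f_ n x| <= `|(EFin \o h) x|)%E}.
  apply: aeW => x n _; rewrite /f_ patchE; case: ifP => //= _.
  by rewrite normr0 lee_fin.
have [_ _ L] := @dominated_convergence _ _ R mu [set: R] measurableT _ _ _ mf mh ff ig fg.
have fE n : (\int[mu]_x f_ n x = (H n%:R - H (- n%:R))%:E)%E.
  have -> : (\int[mu]_x f_ n x = \int[mu]_(x in `[(- n%:R)%R, n%:R]) (h x)%:E)%E.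
    rewrite [RHS]integral_mkcond; apply: eq_integral => x _.
    by rewrite /f_ !patchE; case: ifP.
  have [->|n0] := posnP n.
    by rewrite oppr0 subrr set_itv1 integral_set1.
  rewrite (@continuous_FTC2 _ h H) //.
  - by rewrite gtrN // ltr0n.
  - exact: continuous_subspaceT.
  - split; first by move=> x _; have [] := dH x.
    + by apply: cvg_at_right_filter; exact: cH.
    + by apply: cvg_at_left_filter; exact: cH.
  - by move=> x _; rewrite derive1E; by have [_ ->] := dH x.
have L' : (\int[mu]_x f_ n x)%E @[n --> \oo] --> (0 : R)%:E.
  under eq_fun do rewrite fE.
  by apply: cvg_EFin => //; exact: nearW.
by rewrite /Rintegral (cvg_unique _ L L').
Qed.

End whole_line_FTC.

Section normal_characteristic_function.
Variable R : realType.
Local Notation mu := (@lebesgue_measure R).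

(** The Radon-Nikodym derivative is an abstract choice; it agrees almost everywhere with the density
    because both have the same integral over every measurable set. *)
Lemma integral_normal_prob (m s : R) (f : R -> \bar R) :
  (normal_prob m s).-integrable setT f ->
  (\int[normal_prob m s]_x f x = \int[mu]_x (f x * (normal_pdf m s x)%:E))%E.
Proof.
move=> intf; have dom := normal_prob_dominates m s.
rewrite -(Radon_Nikodym_change_of_variables dom) //=.
apply: ae_eq_integral => //.
- apply: emeasurable_funM; first by case/integrableP: intf.
  by apply: (measurable_int mu); exact: Radon_Nikodym_integrable.
- apply: emeasurable_funM; first by case/integrableP: intf.
  by apply/measurable_EFinP; exact: measurable_normal_pdf.
- apply: ae_eqe_mul2l; rewrite Radon_NikodymE //=.
  case: cid => /= h [h1 h2 h3]; apply: integral_ae_eq => //=.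
  + by apply/measurable_EFinP; exact: measurable_normal_pdf.
  + by move=> E _ mE; rewrite -h3.
Qed.

Local Notation g := (normal_pdf (0 : R) 1).

Lemma std_normal_pdfE : g = fun x => normal_peak 1 * expR (- (x ^+ 2 / 2)).
Proof.
rewrite normal_pdfE ?oner_neq0 //; apply/funext => x.
by rewrite /normal_fun subr0 expr1n mulNr.
Qed.

Lemma is_derive_std_normal_pdf (x : R) : is_derive x (1 : R) g (- x * g x).
Proof.
rewrite std_normal_pdfE.
have d1 : is_derive x (1 : R) (fun x : R => - (x ^+ 2 / 2)) (- x).
  have -> : (fun x : R => - (x ^+ 2 / 2)) = (- 2^-1) \*: (@id R ^+ 2).
    by apply/funext => z; rewrite /= fctE /GRing.scale /=; ring.
  by apply: is_derive_eq; rewrite /GRing.scale /= mulr1; field.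
have d2 : is_derive x (1 : R) (fun x : R => expR (- (x ^+ 2 / 2)))
    (expR (- (x ^+ 2 / 2)) * - x).
  exact: (@is_derive1_comp _ (@expR R)).
have -> : (fun x : R => normal_peak 1 * expR (- (x ^+ 2 / 2))) =
  (normal_peak 1) \*: (fun x : R => expR (- (x ^+ 2 / 2))) by [].
by apply: is_derive_eq; rewrite /GRing.scale /=; ring.
Qed.

(** Since |x| <= 1 + x^2/4 <= exp(x^2/4), a multiple of the centered normal density of variance 2
    dominates; [K] matches the peaks. The function then dominates the derivative in t of the cosine
    integrand. *)
Lemma integrable_normr_std_normal_pdf :
  mu.-integrable setT (EFin \o (fun x => `|x| * g x)).
Proof.
pose K : R := normal_peak 1 / normal_peak (Num.sqrt 2).
have s2 : Num.sqrt 2 != 0 :> R by rewrite gt_eqF // sqrtr_gt0.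
have p2 : 0 < normal_peak (Num.sqrt 2) :> R by rewrite normal_peak_gt0.
have p1 : 0 < normal_peak 1 :> R by rewrite normal_peak_gt0 ?oner_neq0.
have i2 : mu.-integrable setT (EFin \o (fun x => K * normal_pdf 0 (Num.sqrt 2) x)).
  have := integrableZl measurableT K (integrable_normal_pdf 0 (Num.sqrt 2)).
  exact: eq_integrable.
apply: le_integrable i2 => //.
  apply/measurable_EFinP; apply: measurable_funM => //.
  exact: measurable_normal_pdf.
move=> x _ /=; rewrite lee_fin normrM normr_id (ger0_norm (normal_pdf_ge0 0 1 x)).
rewrite [leRHS]ger0_norm; last by rewrite mulr_ge0 ?normal_pdf_ge0 // divr_ge0 // ltW.
rewrite std_normal_pdfE normal_pdfE // /normal_fun subr0 sqr_sqrtr // /K.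
rewrite [leRHS](_ : _ = normal_peak 1 * expR (- x ^+ 2 / (2 *+ 2))); last first.
  by field; rewrite gt_eqF.
rewrite mulrCA ler_pM2l //.
have -> : - (x ^+ 2 / 2) = - x ^+ 2 / (2 *+ 2) - x ^+ 2 / 4 by field.
rewrite expRD mulrCA ler_piMr ?expR_ge0 // expRN ler_pdivrMr ?expR_gt0 // mul1r.
apply: le_trans (expR_ge1Dx _).
rewrite -[x ^+ 2]real_normK ?num_real //.
by have := sqr_ge0 (1 - `|x| / 2); lra.
Qed.

Section cosine_transform.
Variable b : R.

Let h (t x : R) := cos (t * x + b) * g x.
Let h' (t x : R) := - x * sin (t * x + b) * g x.
Let F t := \int[mu]_x h t x.

Let der_h x t : is_derive t (1 : R) (h ^~ x) (h' t x).
Proof.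
rewrite /h /h'.
have d1 : is_derive t (1 : R) (fun t : R => t * x + b) x.
  have -> : (fun t : R => t * x + b) = x \*: @id R + cst b.
    by apply/funext => z; rewrite /= fctE /= mulrC.
  by apply: is_derive_eq; rewrite /GRing.scale /= mulr1 addr0.
have d2 : is_derive t (1 : R) (fun t : R => cos (t * x + b)) (- sin (t * x + b) * x).
  exact: (@is_derive1_comp _ (@cos R)).
have -> : (fun t : R => cos (t * x + b) * g x) = g x \*: (fun t : R => cos (t * x + b)).
  by apply/funext => z; rewrite /= mulrC.
by apply: is_derive_eq; rewrite /GRing.scale /=; ring.
Qed.

Let cont_affine t : continuous (fun x : R => t * x + b).
Proof. by move=> x; apply: cvgD; [apply: cvgMl_tmp; exact: cvg_id | exact: cvg_cst]. Qed.

Let cont_g : continuous g.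
Proof. by apply: continuous_normal_pdf; rewrite oner_neq0. Qed.

Let cont_h t : continuous (h t).
Proof.
move=> x; apply: cvgM; last exact: cont_g.
exact: (@continuous_comp _ _ _ (fun x => t * x + b) cos _
  (@cont_affine t x) (@continuous_cos R _)).
Qed.

Let cont_h' t : continuous (h' t).
Proof.
move=> x; apply: cvgM; last exact: cont_g.
apply: cvgM; first by apply: cvgN; exact: cvg_id.
exact: (@continuous_comp _ _ _ (fun x => t * x + b) sin _
  (@cont_affine t x) (@continuous_sin R _)).
Qed.

Let cos_norm (x : R) : `|cos x| <= 1. Proof. by rewrite ler_norml cos_geN1 cos_le1. Qed.
Let sin_norm (x : R) : `|sin x| <= 1. Proof. by rewrite ler_norml sin_geN1 sin_le1. Qed.

Let h_le t x : `|h t x| <= g x.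
Proof.
rewrite normrM (ger0_norm (normal_pdf_ge0 _ _ _)).
by rewrite ler_piMl ?normal_pdf_ge0.
Qed.

Let h'_le t x : `|h' t x| <= `|x| * g x.
Proof.
rewrite !normrM normrN (ger0_norm (normal_pdf_ge0 _ _ _)).
by rewrite ler_wpM2r ?normal_pdf_ge0 // ler_piMr.
Qed.

Let int_h t : mu.-integrable setT (EFin \o h t).
Proof.
apply: le_integrable (integrable_normal_pdf 0 1) => //.
  by apply/measurable_EFinP; exact: continuous_measurable_fun.
by move=> x _ /=; rewrite lee_fin (ger0_norm (normal_pdf_ge0 _ _ _)).
Qed.

Let int_h' t : mu.-integrable setT (EFin \o h' t).
Proof.
apply: le_integrable integrable_normr_std_normal_pdf => //.
  by apply/measurable_EFinP; exact: continuous_measurable_fun.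
move=> x _ /=; rewrite lee_fin [leRHS]ger0_norm //.
by rewrite mulr_ge0 // normal_pdf_ge0.
Qed.

Let der_F t : is_derive t (1 : R) F (\int[mu]_x h' t x).
Proof.
have It : `](t - 1), (t + 1)[%classic t by rewrite /= in_itv /=; apply/andP; split; lra.
have G0 y : 0 <= `|y| * g y by rewrite mulr_ge0 // normal_pdf_ge0.
have dh s y : `](t - 1), (t + 1)[%classic s -> [set: R] y -> derivable (h ^~ y) s 1.
  by move=> _ _; have [] := der_h y s.
have bound s y : `](t - 1), (t + 1)[%classic s -> [set: R] y ->
    `|partial1of2 h s y| <= `|y| * g y.
  by move=> _ _; rewrite partial1of2E; have [_ ->] := der_h y s.
apply: DeriveDef.
  exact: (derivable_under_integral measurableT It (fun s _ => int_h s) dh G0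
    integrable_normr_std_normal_pdf bound).
rewrite -derive1E (differentiation_under_integral measurableT It (fun s _ => int_h s) dh G0
    integrable_normr_std_normal_pdf bound).
by apply: eq_Rintegral => y _; rewrite partial1of2E; have [_ ->] := der_h y t.
Qed.

(** Integration by parts with g' = -x g: the derivative in x of sin(tx + b) g(x) is
    [h' t x + t * h t x], whose integral is zero. *)
Let int_h'E t : \int[mu]_x h' t x = - t * F t.
Proof.
apply/eqP; rewrite -subr_eq0 mulNr opprK; apply/eqP.
rewrite /F -RintegralZl // -RintegralD //; last first.
  by have := integrableZl measurableT t (int_h t); exact: eq_integrable.
apply: (@Rintegral_derive_eq0 _ (fun x => sin (t * x + b) * g x)).
- move=> x.
  have d1 : is_derive x (1 : R) (fun x : R => t * x + b) t.
    have -> : (fun x : R => t * x + b) = t \*: @id R + cst b.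
      by apply/funext => z; rewrite /= fctE /=.
    by apply: is_derive_eq; rewrite /GRing.scale /= mulr1 addr0.
  have d2 : is_derive x (1 : R) (fun x : R => sin (t * x + b)) (cos (t * x + b) * t).
    exact: (@is_derive1_comp _ (@sin R)).
  have d3 := is_derive_std_normal_pdf x.
  have -> : (fun x : R => sin (t * x + b) * g x) = (fun x : R => sin (t * x + b)) * g by [].
  by apply: is_derive_eq; rewrite /GRing.scale /= /h /h'; ring.
- by move=> x; apply: cvgD; [exact: cont_h' | apply: cvgMl_tmp; exact: cont_h].
- have := integrableD measurableT (int_h' t)
    (@integrableZl _ _ _ mu _ measurableT t (EFin \o h t) (int_h t)).
  exact: eq_integrable.
- have p1 : 0 < normal_peak 1 :> R by rewrite normal_peak_gt0 ?oner_neq0.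
  apply: norm_cvg0.
  (* Each boundary value is at most the peak times exp(-n^2/2) <= 1/(1 + n^2/2) <= 2/(n+1). *)
  apply: (@squeeze_cvgr _ _ _ _ (cst 0) (fun n => 4 * normal_peak 1 * @harmonic R n)).
  + apply: nearW => n; rewrite normr_ge0 /=.
    have bd (x : R) : `|x| = n%:R ->
        `|sin (t * x + b) * g x| <= 2 * normal_peak 1 * n.+1%:R^-1.
      move=> xn; rewrite normrM (ger0_norm (normal_pdf_ge0 _ _ _)).
      apply: le_trans (_ : g x <= _); first by rewrite ler_piMl ?normal_pdf_ge0.
      rewrite std_normal_pdfE mulrC [leRHS]mulrAC ler_pM2r //.
      rewrite expRN -[leRHS]invrK lef_pV2 ?posrE ?expR_gt0 ?invr_gt0 ?divr_gt0 //.
      apply: le_trans (expR_ge1Dx _); rewrite invf_div -[x ^+ 2]real_normK ?num_real // xn.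
      by rewrite -natr1; have := sqr_ge0 (n%:R - 1 / 2 : R); lra.
    apply: le_trans (ler_normB _ _) _.
    rewrite [leRHS](_ : _ = 2 * normal_peak 1 * n.+1%:R^-1 + 2 * normal_peak 1 * n.+1%:R^-1).
      by apply: lerD; apply: bd; rewrite ?normrN ger0_norm.
    by rewrite /harmonic /=; ring.
  + exact: cvg_cst.
  + by rewrite -(mulr0 (4 * normal_peak 1)); apply: cvgMl_tmp; exact: cvg_harmonic.
Qed.

(** As F' = -tF, the product F(s) exp(s^2/2) is constant, equal to its value cos b at 0. *)
Lemma Rintegral_cos_std_normal_pdf t :
  \int[mu]_x (cos (t * x + b) * g x) = cos b * expR (- (t ^+ 2 / 2)).
Proof.
pose K s := F s * expR (s ^+ 2 / 2).
have dK s : is_derive s (1 : R) K 0.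
  have dF := der_F s; rewrite int_h'E in dF.
  have d1 : is_derive s (1 : R) (fun s : R => s ^+ 2 / 2) s.
    have -> : (fun s : R => s ^+ 2 / 2) = 2^-1 \*: (@id R ^+ 2).
      by apply/funext => z; rewrite /= fctE /GRing.scale /= mulrC.
    by apply: is_derive_eq; rewrite /GRing.scale /= mulr1; field.
  have d2 : is_derive s (1 : R) (fun s : R => expR (s ^+ 2 / 2)) (expR (s ^+ 2 / 2) * s).
    exact: (@is_derive1_comp _ (@expR R)).
  have -> : K = F * (fun s : R => expR (s ^+ 2 / 2)) by [].
  by apply: is_derive_eq; rewrite /GRing.scale /=; ring.
have := is_derive_0_is_cst t 0 dK; rewrite /K expr0n /= mul0r expR0 mulr1.
have -> : F 0 = cos b.
  rewrite /F /h; under eq_Rintegral do rewrite mul0r add0r.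
  rewrite RintegralZl //; last exact: (integrable_normal_pdf 0 1).
  by rewrite /Rintegral integral_normal_pdf mulr1.
by move=> <-; rewrite -mulrA -expRD subrr expR0 mulr1.
Qed.

End cosine_transform.

Lemma normal_prob_cos (t b : R) :
  \int[normal_prob 0 1]_x cos (t * x + b) = cos b * expR (- (t ^+ 2 / 2)).
Proof.
rewrite -Rintegral_cos_std_normal_pdf /Rintegral integral_normal_prob //.
exact: (trig_poly_integrable (normal_prob 0 1) (trig_cos t b)).
Qed.

End normal_characteristic_function.

(** * The q-Catalan law *)

Section finite_support.
Context d (T : measurableType d) (R : realType) (P : probability T R).
Variables (X : {RV P >-> R}) (N : nat).
Hypothesis pmf1 : \sum_(k < N) pmf X k%:R = 1.

Let atom (k : nat) : set T := X @^-1` [set k%:R].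

Let measurable_atom k : measurable (atom k).
Proof. by rewrite -[atom k]setTI; apply: measurable_funPT. Qed.

Let P_atom k : P (atom k) = (pmf X k%:R)%:E.
Proof. by rewrite /pmf fineK // fin_num_measure. Qed.

(** Only the masses at the naturals are known; as those below [N] already sum to 1, nothing is left
    for other values. *)
Let ae_atom : {ae P, forall w, exists k : 'I_N, X w = (k : nat)%:R}.
Proof.
have mU : measurable (\big[setU/set0]_(k < N) atom k).
  by apply: bigsetU_measurable => k _.
have P1 : P (\big[setU/set0]_(k < N) atom k) = 1%E.
  have tr : trivIset `I_N atom.
    apply/trivIsetP => i j _ _ ij; apply/seteqP; split=> // w [/= wi wj].
    by move: ij; rewrite -(eqr_nat R) -wi -wj eqxx.
  rewrite measure_semi_additive_ord_I //.
  transitivity (\sum_(k < N) (pmf X k%:R)%:E)%E; last by rewrite sumEFin pmf1.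
  by apply: eq_bigr => k _; exact: P_atom.
exists (~` \big[setU/set0]_(k < N) atom k); split.
- exact: measurableC.
- by rewrite probability_setC // P1 subee.
- move=> w /= H; apply: contra_not H => wU; rewrite -bigcup_mkord in wU.
  by have [k /= kN wk] := wU; exists (Ordinal kN).
Qed.

Lemma integral_finite_support (f : R -> R) : measurable_fun setT f ->
  P.-integrable setT (EFin \o (f \o X)) /\
  (\int[P]_w (f (X w))%:E = (\sum_(k < N) f k%:R * pmf X k%:R)%:E)%E.
Proof.
move=> mf.
pose s w : R := \sum_(k < N) f k%:R * \1_(atom k) w.
have mfX : measurable_fun setT (EFin \o (f \o X)).
  by apply/measurable_EFinP; exact: measurableT_comp.
have i1 k : P.-integrable setT (fun w => (f k%:R * \1_(atom k) w)%:E).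
  have := integrableZl measurableT (f k%:R) (integrable_indic P (measurable_atom k)).
  exact: eq_integrable.
have is_ : P.-integrable setT (EFin \o s).
  have : P.-integrable setT (fun w => \sum_(k < N) (f k%:R * \1_(atom k) w)%:E)%E.
    by apply: integrable_sum.
  by apply: eq_integrable => // w _; rewrite sumEFin.
have ms : measurable_fun setT (EFin \o s) by case/integrableP: is_.
have fs : ae_eq P setT (EFin \o (f \o X)) (EFin \o s).
  move: ae_atom; apply: filterS => w [k Xk] _ /=; congr EFin.
  rewrite /s (bigD1 k) //= big1 ?addr0 => [|j jk].
    by rewrite indicE mem_set // mulr1 Xk.
  rewrite indicE memNset ?mulr0 // /atom /= Xk => /eqP.
  by rewrite eqr_nat => /eqP kj; move/eqP: jk; apply; exact/val_inj.
split.
  apply/integrableP; split=> //; case/integrableP: is_ => _.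
  apply: le_lt_trans.
  rewrite (@ae_eq_integral _ _ _ P setT (fun w => `|(EFin \o s) w|%E)) //.
  - exact: measurableT_comp.
  - exact: measurableT_comp.
  - exact: ae_eq_abse.
rewrite (@ae_eq_integral _ _ _ P setT (EFin \o s)) //.
transitivity (\int[P]_w (\sum_(k < N) (f k%:R * \1_(atom k) w)%:E))%E.
  by apply: eq_integral => w _; rewrite sumEFin.
rewrite integral_sum //; rewrite -sumEFin; apply: eq_bigr => k _.
under eq_integral do rewrite EFinM.
rewrite integralZl //; last exact: integrable_indic.
by rewrite integral_indic // setIT EFinM; congr (_ * _)%E; exact: P_atom.
Qed.

End finite_support.

Section catalan_law.
Variable R : realType.

Lemma sum_coef_moments (p : {poly int}) :
  let toR := map_poly (intr : int -> R) in
  [/\ \sum_(k < size p) (p`_k)%:~R = (toR p).[1],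
    \sum_(k < size p) (p`_k)%:~R * k%:R = (toR p)^`().[1] &
    \sum_(k < size p) (p`_k)%:~R * (k%:R * (k%:R - 1)) = (toR p)^`()^`().[1] ].
Proof.
move=> toR; set N := size p.
have -> : toR p = \sum_(k < N) (p`_k)%:~R *: 'X^k.
  rewrite /toR -[in LHS](coefK p) poly_def rmorph_sum; apply: eq_bigr => k _.
  by rewrite /= map_polyZ /= map_polyXn.
rewrite !raddf_sum /= !horner_sum; split; apply: eq_bigr => k _.
- by rewrite hornerZ hornerXn expr1n mulr1.
- by rewrite derivZ derivXn hornerZ hornerMn hornerXn expr1n.
rewrite derivZ derivXn derivZ derivMn derivXn hornerZ !hornerMn hornerXn expr1n.
case: (nat_of_ord k) => [|m] /=; first by rewrite !mul0r.
by rewrite -(mulr_natl m%:R m.+1) -!natr1; ring.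
Qed.

Local Notation N n := (size (qcatalan n)).
Local Notation w n k := (((qcatalan n)`_k)%:~R / (catalan n)%:R : R).

Lemma catalan_law_moments n : (0 < n)%N ->
  let m := n%:R * (n%:R - 1) / 2 in
  [/\ \sum_(k < N n) w n k = 1,
    \sum_(k < N n) k%:R * w n k = m &
    \sum_(k < N n) (k%:R - m) ^+ 2 * w n k = n%:R * (n%:R ^+ 2 - 1) / 6].
Proof.
move=> n0 m; have [E0 E1 E2] := sum_coef_moments (qcatalan n).
have [] := @qcatalan_moments R n n0; rewrite /pvar /pmean -E0 -E1 -E2.
have C0 : (catalan n)%:R != 0 :> R by rewrite gt_eqF // catalan_gt0.
have -> : \sum_(k < N n) ((qcatalan n)`_k)%:~R = (catalan n)%:R :> R.
  rewrite E0 -[1 in LHS](rmorph1 (intr : int -> R)) horner_map /= qcatalan1.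
  by rewrite rmorph_nat.
set S1 := \sum_(k < N n) _ * k%:R; set S2 := \sum_(k < N n) _ => mE vE.
have w1 : \sum_(k < N n) w n k = 1.
  rewrite -mulr_suml E0 -[1 in LHS](rmorph1 (intr : int -> R)) horner_map /= qcatalan1.
  by rewrite rmorph_nat divff.
have w2 : \sum_(k < N n) k%:R * w n k = m.
  by rewrite /m -mE /S1 mulr_suml; apply: eq_bigr => k _; ring.
split=> //.
(* Derivatives at 1 give factorial moments, hence the split (k - m)^2 = k(k - 1) + (1 - 2m)k +
   m^2. *)
have -> : \sum_(k < N n) (k%:R - m) ^+ 2 * w n k = S2 / (catalan n)%:R +
    (1 - 2 * m) * \sum_(k < N n) k%:R * w n k + m ^+ 2 * \sum_(k < N n) w n k.
  rewrite /S2 mulr_suml !mulr_sumr -!big_split /=; apply: eq_bigr => k _.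
  by ring.
by rewrite w1 w2 -vE mE -/m; ring.
Qed.

Lemma catalan_law_cos n (t b : R) : (0 < n)%N -> 0 < t -> 2 * n%:R * t <= 1 ->
  \sum_(k < N n) cos (2 * t * (k%:R - n%:R * (n%:R - 1) / 2) + b) * w n k =
  cos b * ((\prod_(2 <= j < n.+1) (sin ((n + j)%:R * t) / sin (j%:R * t))) / (catalan n)%:R).
Proof.
move=> n0 t0 nt.
have s0 j : (0 < j <= n)%N -> sin (j%:R * t) != 0.
  move=> /andP[j0 jn]; have j1 : 1 <= j%:R :> R by rewrite ler1n.
  have jn' : j%:R <= n%:R :> R by rewrite ler_nat.
  (* Used with equal arguments only for the positivity of the sine on (0, 1]. *)
  have [] := @sin_ratio_bounds R (j%:R * t) (j%:R * t) (j%:R * t).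
  - by rewrite lexx andbT mulr_gt0 //; lra.
  - exact: lexx.
  - nra.
  by move=> /gt_eqF ->.
have [Ec Es] := qcatalan_cos_sin n0 s0.
transitivity (cos b / (catalan n)%:R *
    \prod_(2 <= j < n.+1) (sin ((n + j)%:R * t) / sin (j%:R * t))
    - sin b / (catalan n)%:R * 0); last by ring.
rewrite -Ec -[X in _ - _ * X]Es !mulr_sumr -sumrB; apply: eq_bigr => k _.
by rewrite cosD; ring.
Qed.

Lemma cvg_catalan_sin_prod (s : R) : 0 < s ->
  let sg n : R := Num.sqrt (n%:R * (n%:R ^+ 2 - 1) / 6) in
  let t n := s / (2 * sg n) in
  (\forall n \near \oo, 0 < t n /\ 2 * n%:R * t n <= 1) /\
  (\prod_(2 <= j < n.+1) (sin ((n + j)%:R * t n) / sin (j%:R * t n))) / (catalan n)%:R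
    @[n --> \oo] --> expR (- (s ^+ 2 / 2)).
Proof.
move=> s0 sg t.
(* The bound n^3/8 is sharp at n = 2: the difference is n(n^2 - 4)/24. *)
have sgE n : (2 <= n)%N -> [/\ 0 < sg n, sg n ^+ 2 = n%:R * (n%:R ^+ 2 - 1) / 6 &
    n%:R ^+ 3 / 8 <= sg n ^+ 2].
  move=> n2; have n2' : 2 <= n%:R :> R by rewrite ler_nat.
  have V0 : 0 < n%:R * (n%:R ^+ 2 - 1) / 6 :> R by rewrite divr_gt0 // mulr_gt0 //; nra.
  rewrite /sg sqrtr_gt0 sqr_sqrtr ?(ltW V0) //; split=> //.
  rewrite -subr_ge0 [leRHS](_ : _ = n%:R / 24 * (n%:R ^+ 2 - 4)); last by field.
  by rewrite mulr_ge0 //; nra.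
have small n : (2 <= n)%N -> (2 * n%:R * t n) ^+ 2 <= 8 * s ^+ 2 / n%:R.
  move=> n2; have [g0 _ g3] := sgE n n2.
  have n0 : 0 < n%:R :> R by rewrite ltr0n; lia.
  have -> : (2 * n%:R * t n) ^+ 2 = n%:R ^+ 2 * s ^+ 2 / sg n ^+ 2.
    by rewrite /t; field; rewrite gt_eqF.
  rewrite ler_pdivrMr ?exprn_gt0 //.
  rewrite [leLHS](_ : _ = 8 * s ^+ 2 / n%:R * (n%:R ^+ 3 / 8)); last by field; rewrite gt_eqF.
  by apply: ler_wpM2l g3; rewrite divr_ge0 ?(ltW n0) // mulr_ge0 ?sqr_ge0.
have near1 : \forall n \near \oo, 0 < t n /\ 2 * n%:R * t n <= 1.
  near=> n; have n2 : (2 <= n)%N by near: n; exists 2%N.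
  have [g0 _ _] := sgE n n2; have t0 : 0 < t n by rewrite divr_gt0 // mulr_gt0.
  split=> //; have n0 : 0 < n%:R :> R by rewrite ltr0n; lia.
  suff : (2 * n%:R * t n) ^+ 2 <= 1.
    by move=> h; rewrite leNgt; apply/negP => ?; nra.
  apply: le_trans (small n n2) _; rewrite ler_pdivrMr // mul1r.
  near: n; exists (Num.truncn (8 * s ^+ 2)).+1 => // n /= sn.
  by apply: le_trans (ltW (truncnS_gt _)) _; rewrite ler_nat.
split=> //.
(* By [small], the remainder 2n(2nt)^4 is at most 128 s^4/n, and 1/n <= 2/(n+1) turns this into a
   multiple of [harmonic]. *)
pose D : R := 256 * s ^+ 4.
have cD : (D * @harmonic R n) @[n --> \oo] --> (0 : R).
  by rewrite -(mulr0 D); apply: cvgMl_tmp; exact: cvg_harmonic.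
apply: (@squeeze_cvgr _ _ _ _ (fun n => expR (- (s ^+ 2 / 2) - D * @harmonic R n))
    (fun n => expR (- (s ^+ 2 / 2) + D * @harmonic R n))).
- near=> n; have n2 : (2 <= n)%N by near: n; exists 2%N.
  have n0 : (0 < n)%N by lia.
  have n0' : 1 <= n%:R :> R by rewrite ler1n.
  have [t0 nt] : 0 < t n /\ 2 * n%:R * t n <= 1 by near: n.
  have [g0 gE _] := sgE n n2.
  have [] := sin_prod_bounds n0 t0 nt.
  have -> : n%:R * (n%:R ^+ 2 - 1) / 3 * t n ^+ 2 = s ^+ 2 / 2.
    have -> : n%:R * (n%:R ^+ 2 - 1) / 3 = 2 * sg n ^+ 2 by rewrite gE; field.
    by rewrite /t; field; rewrite gt_eqF.
  have rD : 2 * n%:R * (2 * n%:R * t n) ^+ 4 <= D * @harmonic R n.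
    have h := small n n2; have h0 := sqr_ge0 (2 * n%:R * t n).
    have -> : (2 * n%:R * t n) ^+ 4 = ((2 * n%:R * t n) ^+ 2) ^+ 2 by rewrite -exprM.
    apply: le_trans (_ : 2 * n%:R * (8 * s ^+ 2 / n%:R) ^+ 2 <= _).
      by rewrite ler_wpM2l ?mulr_ge0 // lerXn2r ?nnegrE // (le_trans h0 h).
    rewrite [leLHS](_ : _ = D / 2 * n%:R^-1); last by rewrite /D; field; lra.
    rewrite /harmonic /= [leRHS](_ : _ = D / 2 * (2 * n.+1%:R^-1));
      last by rewrite mulrA divfK.
    rewrite ler_wpM2l ?divr_ge0 ?mulr_ge0 ?exprn_ge0 ?(ltW s0) //.
    by rewrite ler_pdivlMr ?ltr0n // ler_pdivrMl ?ltr0n // -natr1; lra.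
  move=> lo hi; apply/andP; split.
    by apply: le_trans lo; rewrite ler_expR; lra.
  by apply: le_trans hi _; rewrite ler_expR; lra.
- apply: (cvg_comp _ expR); last exact: continuous_expR.
  have : (- (s ^+ 2 / 2) - D * @harmonic R n) @[n --> \oo] --> - (s ^+ 2 / 2) - 0.
    by apply: cvgB; [exact: cvg_cst | exact: cD].
  by rewrite subr0.
- apply: (cvg_comp _ expR); last exact: continuous_expR.
  have : (- (s ^+ 2 / 2) + D * @harmonic R n) @[n --> \oo] --> - (s ^+ 2 / 2) + 0.
    by apply: cvgD; [exact: cvg_cst | exact: cD].
  by rewrite addr0.
Unshelve. all: by end_near. Qed.

End catalan_law.

(* The type R carries two convertible Borel structures with distinct displays;
   this recasts a random variable from one to the other. *)
Definition borel_rv (R : realType) d (T : measurableType d) (P : probability T R)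
    (X : {RV P >-> R}) : {mfun T >-> measurableTypeR R} :=
  mfun_Sub (mem_set (measurable_funPT X) :
    (X : T -> measurableTypeR R) \in @mfun _ _ T (measurableTypeR R)).

Arguments borel_rv {R d T} P X.

(** * Transfer to the standardized variables and passage to the limit *)

Section main_theorem.
Variable R : realType.

(** These are the two inputs of [levy_continuity]: cosine integrals as finite sums, and a tail bound
    independent of n. The condition on n makes [sg] positive. *)
Lemma standardized_catalan_law d (T : measurableType d) (P : probability T R)
    (X : {RV P >-> R}) n : (1 < n)%N ->
  (forall k : nat, pmf X k%:R = ((qcatalan n)`_k)%:~R / (catalan n)%:R) ->
  let sg : R := Num.sqrt (n%:R * (n%:R ^+ 2 - 1) / 6) in
  let mu := distribution P (borel_rv P (standardize P X)) in
  (forall a b : R, \int[mu]_x cos (a * x + b) =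
    \sum_(k < size (qcatalan n))
      cos (a / sg * (k%:R - n%:R * (n%:R - 1) / 2) + b) *
      (((qcatalan n)`_k)%:~R / (catalan n)%:R)) /\
  (forall A : R, 0 < A -> fine (mu [set x | A < `|x|]) <= A ^- 2).
Proof.
move=> n1 law sg mu.
have n0 : (0 < n)%N by lia.
have n1' : 2 <= n%:R :> R by rewrite ler_nat.
have [w1 w2 w3] := catalan_law_moments R n0.
set m := n%:R * (n%:R - 1) / 2 in w2 w3.
have V0 : 0 < n%:R * (n%:R ^+ 2 - 1) / 6 :> R by rewrite divr_gt0 // mulr_gt0 //; nra.
have sg0 : 0 < sg by rewrite sqrtr_gt0.
have sg2 : sg ^+ 2 = n%:R * (n%:R ^+ 2 - 1) / 6 by rewrite sqr_sqrtr // ltW.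
have pmf1 : \sum_(k < size (qcatalan n)) pmf X k%:R = 1.
  by under eq_bigr do rewrite law.
have intE := integral_finite_support pmf1.
have EX : 'E_P[X]%E = m%:E.
  rewrite unlock; have [_ ->] := intE id (@measurable_id _ _ _).
  by under eq_bigr do rewrite law; rewrite w2.
have VX : 'V_P[X]%E = (sg ^+ 2)%:E.
  rewrite /variance unlock EX /= unlock.
  have msq : measurable_fun setT (fun x : R => (x - m) ^+ 2).
    by apply: measurable_funX; exact: measurable_funB.
  have [_] := intE _ msq; under [X in _ = X%:E -> _]eq_bigr do rewrite law.
  rewrite w3 sg2 => <-; apply: eq_integral => x _; by rewrite expr2.
have stdE x : standardize P X x = (X x - m) / sg.
  by rewrite /standardize EX VX /= sqrtr_sqr ger0_norm // ltW.
split.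
  move=> a b.
  have mcos : measurable_fun setT (fun x : R => cos (a / sg * (x - m) + b)).
    apply: measurableT_comp; first exact: continuous_measurable_fun (@continuous_cos R).
    apply: measurable_funD => //; apply: measurable_funM => //; exact: measurable_funB.
  have [icos Icos] := intE _ mcos.
  have cE : (fun w => (cos (a * standardize P X w + b))%:E) =
      (fun w => (cos (a / sg * (X w - m) + b))%:E).
    by apply/funext => w; rewrite stdE; congr (cos _)%:E; ring.
  have mcos' : measurable_fun [set: measurableTypeR R] (fun y : R => (cos (a * y + b))%:E).
    apply/measurable_EFinP; apply: continuous_measurable_fun.
    by apply: trig_poly_continuous; exact: trig_cos.
  have icos' : P.-integrable setT (fun w => (cos (a * standardize P X w + b))%:E).
    by rewrite cE.
  rewrite /Rintegral (@integral_distribution _ _ _ (measurableTypeR R) _ P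
    (borel_rv P (standardize P X)) _ mcos' icos').
  rewrite [X in fine (integral _ _ X)]cE Icos /=.
  by apply: eq_bigr => k _; rewrite law.
move=> A A0.
rewrite -lee_fin fineK; last first.
  by apply: fin_num_measure; exact: measurable_tail.
(* Chebyshev's inequality at the level A [sg], so that the variance cancels. *)
have Asg : 0 < A * sg by rewrite mulr_gt0.
have := chebyshev X Asg; rewrite EX VX /=.
have -> : (((A * sg) ^- 2)%:E * (sg ^+ 2)%:E = (A ^- 2)%:E)%E.
  by rewrite -EFinM; congr EFin; field; rewrite !gt_eqF.
move=> cheb; apply: le_trans cheb.
have : (P (standardize P X @^-1` [set x | A < `|x|]%R) <=
        P [set w | A * sg <= `|X w - m|]%R)%E; last by [].
apply: le_measure; rewrite ?inE.
- by have := measurable_standardize X measurableT (measurable_tail A); rewrite setTI.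
- have mf : measurable_fun setT (fun w => `|X w - m|).
    by apply: measurableT_comp => //; exact: measurable_funB.
  have := mf measurableT `[A * sg, +oo[%classic (measurable_itv _).
  rewrite setTI; congr measurable; apply/seteqP.
  by split=> w /=; rewrite in_itv /= andbT.
move=> w /=; rewrite stdE normrM normfV (gtr0_norm sg0) ltr_pdivlMr //.
exact: ltW.
Qed.

End main_theorem.

Theorem theorem2p3 (R : realType) (d : nat -> measure_display)
    (T : forall n, measurableType (d n)) (P : forall n, probability (T n) R)
    (xi : forall n, {RV (P n) >-> R})
    (xi_law : forall n k : nat, (1 <= n)%N ->
      pmf (xi n) k%:R = ((qcatalan n)`_k)%:~R / (catalan n)%:R) :
  cvg_in_distribution P (fun n => standardize (P n) (xi n)) (normal_prob 0 1).
Proof.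
have law n (n1 : (1 < n)%N) := standardized_catalan_law n1 (fun k => xi_law n k (ltnW n1)).
pose mu_ n : probability (measurableTypeR R) R :=
  distribution (P n) (borel_rv (P n) (standardize (P n) (xi n))).
move=> x cx.
apply: (@levy_continuity R mu_ (normal_prob 0 1)) cx.
(* The sine bounds require a positive angle. Negative [a] is reduced to this case by evenness of the
   cosine, and [a = 0] gives a constant. *)
- have pos a b : 0 < a ->
      \int[mu_ n]_x cos (a * x + b) @[n --> \oo] --> \int[normal_prob 0 1]_x cos (a * x + b).
    move=> a0; have [near1 cvg1] := cvg_catalan_sin_prod a0.
    rewrite normal_prob_cos.
    have {}cvg1 := cvgM (cvg_cst (cos b)) cvg1.
    suff E : \forall n \near \oo, cos b * (\prod_(2 <= j < n.+1)
        (sin ((n + j)%:R * (a / (2 * Num.sqrt (n%:R * (n%:R ^+ 2 - 1) / 6)))) /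
         sin (j%:R * (a / (2 * Num.sqrt (n%:R * (n%:R ^+ 2 - 1) / 6))))) / (catalan n)%:R) =
        \int[mu_ n]_x cos (a * x + b).
      apply: (cvg_trans (near_eq_cvg E)). exact: cvg1.
    near=> n.
    have n1 : (1 < n)%N by near: n; exists 2%N.
    have [t0 nt] : 0 < a / (2 * Num.sqrt (n%:R * (n%:R ^+ 2 - 1) / 6)) /\
        2 * n%:R * (a / (2 * Num.sqrt (n%:R * (n%:R ^+ 2 - 1) / 6))) <= 1.
      by near: n.
    have [-> _] := law n n1.
    rewrite -(catalan_law_cos b (ltnW n1) t0 nt); apply: eq_bigr => k _.
    congr (cos (_ * _ + _) * _).
    have n2 : 2 <= n%:R :> R by rewrite ler_nat.
    have V0 : 0 < n%:R * (n%:R ^+ 2 - 1) / 6 :> R by rewrite divr_gt0 // mulr_gt0 //; nra.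
    by field; rewrite gt_eqF // sqrtr_gt0.
  move=> a b; have [a0|a0|<-] := ltgtP 0 a; first exact: pos.
    have E : (fun x : R => cos (a * x + b)) = (fun x => cos (- a * x + - b)).
      by apply/funext => y; rewrite -cosN; congr cos; ring.
    by rewrite E; apply: pos; rewrite oppr_gt0.
  have cst_int (mu : probability (measurableTypeR R) R) :
      \int[mu]_x cos (0 * x + b) = cos b.
    under eq_Rintegral do rewrite mul0r add0r.
    by rewrite Rintegral_cst // [X in fine X](_ : _ = 1%E) ?mulr1 //; exact: probability_setT.
  rewrite cst_int; under eq_fun do rewrite cst_int; exact: cvg_cst.
(* With this A the bound A^-2 is exactly [e], for all n >= 2. *)
- move=> e e0; exists (Num.sqrt (e^-1)); exists 2%N => // n /= n1.
  have [_ tl] := law n n1; apply: le_trans (tl _ _) _; first by rewrite sqrtr_gt0 invr_gt0.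
  by rewrite sqr_sqrtr ?invrK // invr_ge0 ltW.
Unshelve. all: by end_near. Qed.
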